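(* Let $d\geqslant 2$ be an integer, let $\lambda>0$ and let $\mu\geqslant -\frac12$. Let $\tilde{\mathbb{K}}_n(x,y)$ be the $n$-th kernel of the inner product $\langle\cdot,\cdot\rangle_\mu^\lambda$ on the unit ball of $\mathbb{R}^d$. Then for every $x\in\mathbb{R}^d$ with $\|x\|=1$, $$\lim_{n\to\infty}\frac{\tilde{\mathbb{K}}_n(x,x)}{\binom{n+d-1}{n}}=\frac{2}{\lambda}.$$
   Context: $\mathbb{B}^d=\{x\in\mathbb{R}^d:\|x\|\leqslant 1\}$ and $\mathbb{S}^{d-1}=\{\xi\in\mathbb{R}^d:\|\xi\|=1\}$ with the Euclidean norm; $d\sigma$ is the surface measure on $\mathbb{S}^{d-1}$ and $\sigma_{d-1}=\int_{\mathbb{S}^{d-1}}d\sigma=2\pi^{d/2}/\Gamma(d/2)$. For $\mu>-1$, $W_\mu(x)=(1-\|x\|^2)^\mu$ and $\omega_\mu=\int_{\mathbb{B}^d}W_\mu(x)\,dx=\pi^{d/2}\Gamma(\mu+1)/\Gamma(\mu+1+d/2)$. For $\lambda>0$ the inner product on real polynomials in $d$ variables is $$\langle f,g\rangle_\mu^\lambda=\frac1{\omega_\mu}\int_{\mathbb{B}^d}f(x)g(x)W_\mu(x)\,dx+\frac{\lambda}{\sigma_{d-1}}\int_{\mathbb{S}^{d-1}}f(\xi)g(\xi)\,d\sigma(\xi).$$ Let $\Pi_n^d$ be the space of real polynomials in $d$ variables of total degree at most $n$. The $n$-th kernel is $\tilde{\mathbb{K}}_n(x,y)=\sum_i \frac{Q_i(x)Q_i(y)}{\langle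 Q_i,Q_i\rangle_\mu^\lambda}$, where $\{Q_i\}$ is any basis of $\Pi_n^d$ whose elements are mutually orthogonal with respect to $\langle\cdot,\cdot\rangle_\mu^\lambda$ (the sum does not depend on the choice of the basis). *)

(* Defs.v *)
From HB Require Import structures.
From mathcomp Require Import all_boot all_order all_algebra.
From mathcomp Require Import all_classical all_reals all_analysis.
(* The notations and names of mpoly clash with those of analysis; only the
   algebraic structures are imported, and the rest is used qualified. *)
From mathcomp Require Import (canonicals, coercions) mpoly.

Set Implicit Arguments.
Unset Strict Implicit.
Unset Printing Implicit Defensive.

Import Order.TTheory GRing.Theory Num.Theory.
Import numFieldNormedType.Exports.

Local Open Scope classical_set_scope.
Local Open Scope ring_scope.

Section cons_pair.
Context d (T : measurableType d) (n : nat).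

Definition cons_pair (p : T * n.-tuple T) : n.+1.-tuple T :=
  [tuple of p.1 :: p.2].

Let measurable_cons_pair : measurable_fun [set: T * n.-tuple T] cons_pair.
Proof.
exact: (@measurable_cons _ _ (T * n.-tuple T)%type T fst n snd
  measurable_fst measurable_snd).
Qed.

HB.instance Definition _ := isMeasurableFun.Build _ _ _ _ cons_pair
  measurable_cons_pair.

Definition uncons (t : n.+1.-tuple T) : T * n.-tuple T :=
  (thead t, [tuple of behead t]).

Lemma measurable_uncons : measurable_fun [set: n.+1.-tuple T] uncons.
Proof.
apply/measurable_fun_pairP; split.
  exact: measurable_tnth.
exact: measurable_behead.
Qed.

Lemma cons_pairK : cancel cons_pair uncons.
Proof. by case=> x t; rewrite /uncons theadE; congr (_, _); apply/val_inj. Qed.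

Lemma unconsK : cancel uncons cons_pair.
Proof. by move=> t; rewrite /cons_pair [RHS]tuple_eta. Qed.

End cons_pair.

Section cons_measure.
Local Open Scope ereal_scope.
Context d (T : measurableType d) (R : realType) (n : nat).
Variables (m1 : {sigma_finite_measure set T -> \bar R})
          (m2 : {sigma_finite_measure set (n.-tuple T) -> \bar R}).

(* The product measure m1 \x m2 carried over to n.+1.-tuple T. *)
Definition cons_measure : set (n.+1.-tuple T) -> \bar R :=
  pushforward (m1 \x m2) (@cons_pair _ T n).

Let cons_measure0 : cons_measure set0 = 0.
Proof. exact: measure0. Qed.

Let cons_measure_ge0 A : 0 <= cons_measure A.
Proof. exact: measure_ge0. Qed.

Let cons_measure_sigma_additive : semi_sigma_additive cons_measure.
Proof. exact: measure_semi_sigma_additive. Qed.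

HB.instance Definition _ := isMeasure.Build _ _ _ cons_measure
  cons_measure0 cons_measure_ge0 cons_measure_sigma_additive.

Let cons_measure_sigma_finite : sigma_finite setT cons_measure.
Proof.
have /sigma_finiteP[F [TF ndF Foo]] := sigma_finiteT m1.
have /sigma_finiteP[G [TG ndG Goo]] := sigma_finiteT m2.
exists (fun k => @uncons _ T n @^-1` (F k `*` G k)).
  rewrite -preimage_bigcup (_ : \bigcup_k _ = setT) ?preimage_setT//.
  rewrite -subTset => -[x t] _ /=.
  have [i _ Fix] : (\bigcup_k F k) x by rewrite -TF.
  have [j _ Gjt] : (\bigcup_k G k) t by rewrite -TG.
  exists (maxn i j) => //; split.
    by move: x Fix; exact/subsetPset/ndF/leq_maxl.
  by move: t Gjt; exact/subsetPset/ndG/leq_maxr.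
move=> k; have [mF Fk] := Foo k; have [mG Gk] := Goo k; split.
  by rewrite -[X in measurable X]setTI; apply: measurable_uncons => //;
    exact: measurableX.
rewrite /cons_measure /pushforward -comp_preimage.
rewrite (_ : @uncons _ T n \o @cons_pair _ T n = id); last first.
  by apply/funext => p /=; rewrite cons_pairK.
by rewrite preimage_id product_measure1E// lte_mul_pinfty// ge0_fin_numE.
Qed.

HB.instance Definition _ := Measure_isSigmaFinite.Build _ _ _ cons_measure
  cons_measure_sigma_finite.

End cons_measure.

(* Carries the product of the Borel sigma-algebras of R. *)
Notation euclidean R d := (d.-tuple (measurableTypeR R)).

(* d-dimensional Lebesgue measure. *)
Fixpoint lebesgue_tuple (R : realType) (d : nat) :
    {sigma_finite_measure set (euclidean R d) -> \bar R} :=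
  match d with
  | 0 => \d_([tuple] : euclidean R 0)
  | d'.+1 => cons_measure (@lebesgue_measure R) (lebesgue_tuple R d')
  end.

Section euclidean_norm.
Variables (R : realType) (d : nat).
Implicit Types x : euclidean R d.

Definition enorm x : R := Num.sqrt (\sum_(i < d) tnth x i ^+ 2).

Definition unit_ball : set (euclidean R d) := [set x | enorm x <= 1].

Definition unit_sphere : set (euclidean R d) := [set x | enorm x = 1].

Definition punctured_ball : set (euclidean R d) := [set x | 0 < enorm x <= 1].

(* x / |x|; the value at x = 0, namely 0, is irrelevant. *)
Definition radial x : euclidean R d := [tuple tnth x i / enorm x | i < d].

Lemma enorm_ge0 x : 0 <= enorm x.
Proof. exact: sqrtr_ge0. Qed.

Lemma measurable_enorm : measurable_fun [set: euclidean R d] enorm.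
Proof.
apply: measurableT_comp.
  by apply: measurable_realfun.continuous_measurable_fun; exact: sqrt_continuous.
apply: measurable_sum => i; apply: measurable_realfun.measurable_funX.
exact: measurable_tnth.
Qed.

Lemma measurable_punctured_ball : measurable punctured_ball.
Proof.
rewrite (_ : punctured_ball = enorm @^-1` `]0, 1]%classic).
  by rewrite -[X in measurable X]setTI; exact: measurable_enorm.
by apply/seteqP; split => x /=; rewrite in_itv.
Qed.

Lemma measurable_radial : measurable_fun [set: euclidean R d] radial.
Proof.
apply/measurable_fun_tnthP => i.
rewrite (_ : _ \o _ = (fun x => tnth x i * enorm x `^ (-1))); last first.
  by apply/funext => x /=; rewrite tnth_mktuple powR_inv1// enorm_ge0.
apply: measurable_realfun.measurable_funM; first exact: measurable_tnth.
apply: (measurableT_comp (measurable_realfun.measurable_powR _)).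
exact: measurable_enorm.
Qed.

(* The surface measure, as the cone measure
     A |-> d * vol {x | 0 < |x| <= 1 /\ x / |x| \in A},
   the factor d being the one of the polar coordinates formula
     dx = r ^ (d - 1) dr dsigma. *)
Definition surface_measure (A : set (euclidean R d)) : \bar R :=
  (d%:R%:E * lebesgue_tuple R d (radial @^-1` A `&` punctured_ball))%E.

Let restricted : {measure set (euclidean R d) -> \bar R} :=
  mrestr (lebesgue_tuple R d) measurable_punctured_ball.

Let image : {measure set (euclidean R d) -> \bar R} :=
  measure_function_pushforward__canonical__measure_function_Measure
    restricted measurable_radial.

Let scaled : {measure set (euclidean R d) -> \bar R} :=
  mscale d%:R%:nng image.

Let surface_measure0 : surface_measure set0 = 0%E.
Proof. exact: (measure0 scaled). Qed.

Let surface_measure_ge0 A : (0 <= surface_measure A)%E.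
Proof. exact: (measure_ge0 scaled). Qed.

Let surface_measure_sigma_additive : semi_sigma_additive surface_measure.
Proof. exact: (@measure_semi_sigma_additive _ _ _ scaled). Qed.

HB.instance Definition _ := isMeasure.Build _ _ _ surface_measure
  surface_measure0 surface_measure_ge0 surface_measure_sigma_additive.

End euclidean_norm.
Arguments unit_ball {R d}.
Arguments unit_sphere {R d}.

Section ball_inner_product.
Variables (R : realType) (d : nat) (mu lambda : R).
Implicit Types (x y : euclidean R d) (f g : mpoly.mpoly d R).

Definition peval f x : R := mpoly.meval (tnth x) f.

(* For mu < 0 the value on the sphere is irrelevant: the sphere is a null set. *)
Definition weight x : R := (1 - enorm x ^+ 2) `^ mu.

Definition weight_mass : R := \int[lebesgue_tuple R d]_(x in unit_ball) weight x.

Definition sphere_area : R := \int[@surface_measure R d]_(x in unit_sphere) 1.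

Definition ball_inner f g : R :=
  weight_mass^-1 * (\int[lebesgue_tuple R d]_(x in unit_ball)
                (peval f x * peval g x * weight x))
  + lambda / sphere_area * (\int[@surface_measure R d]_(x in unit_sphere)
                              (peval f x * peval g x)).

(* msize is 1 + the total degree, and 0 for the zero polynomial. *)
Definition degree_le (n : nat) f : Prop := (mpoly.msize f <= n.+1)%N.

(* Q is a basis of the space of polynomials of total degree at most n. *)
Definition poly_basis (n : nat) (Q : seq (mpoly.mpoly d R)) : Prop :=
  [/\ forall i : 'I_(size Q), degree_le n Q`_i,
      forall c : 'I_(size Q) -> R,
        \sum_(i < size Q) c i *: Q`_i = 0 -> forall i, c i = 0 &
      forall f, degree_le n f ->
        exists c : 'I_(size Q) -> R, f = \sum_(i < size Q) c i *: Q`_i].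

Definition orthogonal_basis (n : nat) (Q : seq (mpoly.mpoly d R)) : Prop :=
  poly_basis n Q /\
  forall i j : 'I_(size Q), i != j -> ball_inner Q`_i Q`_j = 0.

Definition polynomial_kernel (Q : seq (mpoly.mpoly d R)) x y : R :=
  \sum_(q <- Q) peval q x * peval q y / ball_inner q q.

End ball_inner_product.

(* Main.v *)
(* Write mean for the normalized integral over the sphere. The value
   K_n(x, x) is the maximum of f(x)^2 / <f, f> over the polynomials f of degree
   at most n. On the sphere every such f coincides with an element of
   V = P_n + P_(n-1), where P_k is the space of homogeneous polynomials of degree
   k, and dim V = N = 'C(n+d-1, n) + 'C(n+d-2, n-1). The reproducing kernel of V
   for the mean is invariant under rotations, hence constant on the diagonal,
   and the trace shows that the constant is N.

   Upper bound: <f, f> >= lambda * mean (f^2) and f(x)^2 <= N * mean (f^2), so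
   that K_n(x, x) <= N / lambda.

   Lower bound: for f in V, polar coordinates show that the part of <f, f> coming
   from the ball is at most e_n * mean (f^2), where e_n is bounded by moments
   int |x|^m W(x) dx that tend to 0 as m grows. Taking for f the reproducing
   kernel of V at x yields K_n(x, x) >= N / (lambda + e_n).

   Finally N / 'C(n+d-1, n) tends to 2. *)
Require Import Defs.
From HB Require Import structures.
From mathcomp Require Import all_boot all_order all_algebra.
From mathcomp Require Import zify ring lra.
From mathcomp Require Import all_classical all_reals all_analysis.
From mathcomp Require Import measurable_realfun.
From mathcomp Require Import (canonicals, coercions) mpoly.

Set Implicit Arguments.
Unset Strict Implicit.
Unset Printing Implicit Defensive.

Import Order.TTheory GRing.Theory Num.Theory.
Import numFieldNormedType.Exports.

Local Open Scope classical_set_scope.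
Local Open Scope ring_scope.

(** * Invariance properties of the Lebesgue measure *)

(** What shapes the proof is the rotation invariance of [surface_measure], a cone measure over an
    iterated product of Lebesgue measures. Such a product shows invariance only fibrewise, for
    translations and scalings of one coordinate; rotations are therefore factored into shears, and
    volume preservation is carried along in [isometry]. The same cone description makes polar
    coordinates a statement of independence between finite measures. Two degrees enter because |x|^2
    = 1 on the sphere shifts degrees only by even amounts; their opposite parities make the two
    homogeneous parts orthogonal for the mean. The constant e_n is twice the sum of the moments of
    orders 2n and 2n - 2: the factor 2 comes from (p + q)^2 <= 2 p^2 + 2 q^2, which removes the
    mixed product, whose sign varies. The kernel of V requires an invertible Gram matrix, and
    transitivity of the isometries yields this too. *)

Section volume_scaling.
Variable R : realType.
Local Notation E n := (euclidean R n).
Local Notation leb := (@lebesgue_measure R).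
Local Notation vol n := (lebesgue_tuple R n).
Local Notation cons n := (@cons_pair _ (measurableTypeR R) n).

Lemma measurable_preimage d1 d2 (T1 : measurableType d1) (T2 : measurableType d2)
    (f : T1 -> T2) (A : set T2) :
  measurable_fun setT f -> measurable A -> measurable (f @^-1` A).
Proof. by move=> mf mA; rewrite -[X in measurable X]setTI; exact: mf. Qed.

Lemma lebesgue_tuple_xsection n (A : set (E n.+1)) :
  vol n.+1 A = (\int[leb]_s vol n (xsection (cons n @^-1` A) s))%E.
Proof. by []. Qed.

Lemma measurable_cons_preimage n (A : set (E n.+1)) :
  measurable A -> measurable (cons n @^-1` A).
Proof. exact: (measurable_preimage (measurable_funP (cons n))). Qed.

(** The product taken in the opposite order agrees on rectangles, hence everywhere. The definition
    slices at a fixed first coordinate; maps that move the first coordinate need the slices at a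
    fixed tail. *)
Lemma lebesgue_tuple_ysection n (A : set (E n.+1)) : measurable A ->
  vol n.+1 A = (\int[vol n]_t leb (ysection (cons n @^-1` A) t))%E.
Proof.
move=> mA; rewrite -[RHS]/((leb \x^ vol n)%E _).
apply: (product_measure_unique (m' := (leb \x^ vol n)%E)).
  by move=> B C mB mC; rewrite -product_measure2E.
exact: measurable_cons_preimage.
Qed.

(* The linear maps below satisfy this with c the absolute value of their
   determinant. *)
Definition scales n (c : R) (f : E n -> E n) :=
  measurable_fun setT f /\
  forall A, measurable A -> (c%:E * vol n (f @^-1` A) = vol n A)%E.

Lemma scales_comp n c1 c2 (f1 f2 : E n -> E n) :
  scales c1 f1 -> scales c2 f2 -> scales (c1 * c2) (f1 \o f2).
Proof.
move=> [m1 h1] [m2 h2]; split; first exact: measurableT_comp.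
move=> A mA; rewrite comp_preimage EFinM -muleA h2 ?h1//.
exact: measurable_preimage.
Qed.

(** Slicing at a fixed tail [t] turns [f] into the map [g t] of the line, and the factor [c], common
    to all [t], leaves the integral. *)
Lemma scales_xfiber n (c : R) (f : E n.+1 -> E n.+1) (g : E n -> R -> R) :
  0 <= c -> measurable_fun setT f ->
  (forall s t, f (cons n (s, t)) = cons n (g t s, t)) ->
  (forall t B, measurable B -> (c%:E * leb (g t @^-1` B) = leb B)%E) ->
  scales c f.
Proof.
move=> c0 mf fE gE; split=> // A mA.
have mfA := measurable_preimage mf mA.
rewrite !lebesgue_tuple_ysection// -ge0_integralZl//.
- apply: eq_integral => t _; rewrite -[RHS](gE t); last first.
    by apply: measurable_ysection; exact: measurable_cons_preimage.
  congr (_ * leb _)%E; apply/seteqP; split=> s /=;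
    by rewrite /ysection/= !inE /= fE.
- by apply: measurable_fun_ysection; exact: measurable_cons_preimage.
Qed.

Lemma scales_yfiber n (c : R) (f : E n.+1 -> E n.+1) (g : R -> E n -> E n) :
  0 <= c -> measurable_fun setT f ->
  (forall s t, f (cons n (s, t)) = cons n (s, g s t)) ->
  (forall s, scales c (g s)) ->
  scales c f.
Proof.
move=> c0 mf fE gE; split=> // A mA.
have mfA := measurable_preimage mf mA.
rewrite !lebesgue_tuple_xsection// -ge0_integralZl//.
- apply: eq_integral => s _; rewrite -[RHS](gE s).2; last first.
    by apply: measurable_xsection; exact: measurable_cons_preimage.
  congr (_ * vol _ _)%E; apply/seteqP; split=> t /=;
    by rewrite /xsection/= !inE /= fE.
- by apply: measurable_fun_xsection; exact: measurable_cons_preimage.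
Qed.

(** The scaled pushforward of the Lebesgue measure agrees with it on half-open intervals, and these
    determine it. *)
Lemma lebesgue_measure_affine (a b : R) (A : set R) : 0 < a -> measurable A ->
  (a%:E * leb ((fun s : R => (a * s + b)%R) @^-1` A) = leb A)%E.
Proof.
move=> a0 mA.
have mf : measurable_fun setT ((fun s => a * s + b) : measurableTypeR R -> measurableTypeR R).
  by apply: measurable_funD => //;
     exact: measurable_funM.
pose m := mscale (NngNum (ltW a0))
  (measure_function_pushforward__canonical__measure_function_Measure leb mf).
rewrite -[LHS]/(m A); apply/esym.
apply: (lebesgue_measure_unique (mu := m)) => // _ [[x y]] _ <-.
rewrite -[RHS]/(a%:E * leb ((fun s : R => (a * s + b)%R) @^-1` `]x, y]%classic))%E.
have -> : (fun s : R => a * s + b) @^-1` `]x, y]%classic = `](x - b) / a, (y - b) / a]%classic.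
  apply/seteqP; split=> s /=; rewrite !in_itv/=;
    by rewrite ltr_pdivrMr// ler_pdivlMr// ltrBlDr lerBrDr [s * a]mulrC.
rewrite !lebesgue_measure_itv/= !lte_fin ltr_pM2r ?invr_gt0// ltrD2r.
case: ifP => _; last by rewrite mule0.
by rewrite -!EFinD -EFinM; congr (_%:E); field; rewrite gt_eqF.
Qed.

Lemma lebesgue_measure_shift (b : R) (A : set R) : measurable A ->
  leb ((fun s : R => s + b) @^-1` A) = leb A.
Proof.
move=> mA; rewrite -[RHS](lebesgue_measure_affine b ltr01 mA) mul1e.
by congr leb; apply/seteqP; split=> s /=; rewrite mul1r.
Qed.

Lemma lebesgue_measure_scale (a : R) (A : set R) : a != 0 -> measurable A ->
  (`|a|%:E * leb ((fun s : R => (a * s)%R) @^-1` A) = leb A)%E.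
Proof.
move=> a0 mA; case: (ltgtP a 0) a0 => // a0 _; last first.
  rewrite gtr0_norm// -[RHS](lebesgue_measure_affine 0 a0 mA).
  by congr (_ * leb _)%E; apply/seteqP; split=> s /=; rewrite addr0.
(* For [a < 0], a reflection reduces to the positive factor [- a]. *)
rewrite ltr0_norm// -[RHS]lebesgue_measureN//.
have na0 : 0 < - a by rewrite oppr_gt0.
rewrite -[RHS](lebesgue_measure_affine 0 na0); last first.
  by apply: measurable_preimage => //; exact: oppr_measurable.
by congr (_ * leb _)%E; apply/seteqP; split=> s /=; rewrite addr0 mulNr opprK.
Qed.

Lemma euclideanS n (x : E n.+1) : exists s t, x = cons n (s, t).
Proof. by exists (thead x), [tuple of behead x]; rewrite [LHS]tuple_eta; apply/val_inj. Qed.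

Lemma thead_cons n s t : thead (cons n (s, t)) = s.
Proof. by rewrite theadE. Qed.

Lemma behead_cons n s t : [tuple of behead (cons n (s, t))] = t.
Proof. exact/val_inj. Qed.

Lemma tnth_cons0 n s t : tnth (cons n (s, t)) ord0 = s.
Proof. by []. Qed.

Lemma tnth_consS n s t (i : 'I_n) : tnth (cons n (s, t)) (lift ord0 i) = tnth t i.
Proof. by rewrite tnthS; congr tnth; apply/val_inj. Qed.

Definition translation n (v x : E n) : E n := [tuple tnth x i + tnth v i | i < n].

Definition homothety n (a : R) (x : E n) : E n := [tuple a * tnth x i | i < n].

Definition dotp n (u v : E n) : R := \sum_(i < n) tnth u i * tnth v i.

Lemma measurable_tuple_fun d (T : measurableType d) n (f : T -> 'I_n -> R) :
  (forall i, measurable_fun setT (f^~ i)) ->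
  measurable_fun setT ((fun x => [tuple f x i | i < n]) : T -> E n).
Proof.
move=> mf; apply/measurable_fun_tnthP => i; apply: eq_measurable_fun (mf i).
by move=> x _ /=; rewrite tnth_mktuple.
Qed.

Lemma measurable_translation n (v : E n) : measurable_fun setT (translation v).
Proof.
apply: measurable_tuple_fun => i; apply: measurable_funD => //.
exact: measurable_tnth.
Qed.

Lemma measurable_homothety n (a : R) : measurable_fun setT (@homothety n a).
Proof.
apply: measurable_tuple_fun => i; apply: measurable_funM => //.
exact: measurable_tnth.
Qed.

Lemma measurable_dotp n (w : E n) : measurable_fun setT (dotp w).
Proof.
apply: measurable_sum => i; apply: measurable_funM => //.
exact: measurable_tnth.
Qed.

Lemma tuple0_eq (x y : E 0) : x = y.
Proof. by rewrite [x]tuple0 [y]tuple0. Qed.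

Lemma scales_id0 c (f : E 0 -> E 0) : c = 1 -> scales c f.
Proof.
move=> ->; have -> : f = id by apply/funext => x; exact: tuple0_eq.
by split=> [|A mA]; [exact: measurable_id|rewrite mul1e].
Qed.

Lemma scales_translation n (v : E n) : scales 1 (translation v).
Proof.
elim: n v => [|n IH] v; first exact: scales_id0.
have [s [t vE]] := euclideanS v.
have -> : translation v =
  (fun x => cons n (thead x + s, [tuple of behead x])) \o
  (fun x => cons n (thead x, translation t [tuple of behead x])).
  apply/funext => x; have [a [b ->]] := euclideanS x.
  rewrite vE [RHS]/= !(thead_cons, behead_cons).
  apply/eq_from_tnth => i; rewrite tnth_mktuple.
  case: (unliftP ord0 i) => [j|] -> //.
  by rewrite !tnth_consS tnth_mktuple.
rewrite -[1]mulr1; apply: scales_comp.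
  apply: (scales_xfiber (g := fun _ a => a + s)) => //.
  - apply: measurable_cons; last exact: measurable_behead.
    by apply: measurable_funD => //; exact: measurable_tnth.
  - by move=> a b; rewrite /= theadE; congr (cons n (_, _)); apply/val_inj.
  - by move=> _ B mB; rewrite mul1e lebesgue_measure_shift.
apply: (scales_yfiber (g := fun _ => translation t)) => //.
- apply: measurable_cons; first exact: measurable_tnth.
  exact: (measurableT_comp (measurable_translation t) (@measurable_behead _ _ _)).
- by move=> a b; rewrite thead_cons behead_cons.
Qed.

Lemma scales_homothety n (a : R) : a != 0 -> scales (`|a| ^+ n) (@homothety n a).
Proof.
move=> a0; elim: n => [|n IH]; first exact: scales_id0.
have -> : @homothety n.+1 a =
  (fun x => cons n (a * thead x, [tuple of behead x])) \o
  (fun x => cons n (thead x, homothety a [tuple of behead x])).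
  apply/funext => x; have [s [t ->]] := euclideanS x.
  rewrite [RHS]/= !(thead_cons, behead_cons).
  apply/eq_from_tnth => i; rewrite tnth_mktuple.
  case: (unliftP ord0 i) => [j|] -> //.
  by rewrite !tnth_consS tnth_mktuple.
rewrite exprS; apply: scales_comp.
  apply: (scales_xfiber (g := fun _ s => a * s)) => //.
  - apply: measurable_cons; last exact: measurable_behead.
    by apply: measurable_funM => //; exact: measurable_tnth.
  - by move=> s t; rewrite /= theadE; congr (cons n (_, _)); apply/val_inj.
  - by move=> _ B mB; rewrite lebesgue_measure_scale.
apply: (scales_yfiber (g := fun _ => homothety a)) => //.
- apply: measurable_cons; first exact: measurable_tnth.
  exact: (measurableT_comp (measurable_homothety a) (@measurable_behead _ _ _)).
- by move=> s t; rewrite thead_cons behead_cons.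
Qed.

Definition xshear n (w : E n) (x : E n.+1) : E n.+1 :=
  cons n (thead x + dotp w [tuple of behead x], [tuple of behead x]).

Definition yshear n (w : E n) (x : E n.+1) : E n.+1 :=
  cons n (thead x, translation (homothety (thead x) w) [tuple of behead x]).

Lemma xshearE n (w : E n) s t : xshear w (cons n (s, t)) = cons n (s + dotp w t, t).
Proof.
by rewrite /xshear thead_cons behead_cons.
Qed.

Lemma yshearE n (w : E n) s t :
  yshear w (cons n (s, t)) = cons n (s, translation (homothety s w) t).
Proof.
by rewrite /yshear thead_cons behead_cons.
Qed.

(** A shear translates each fibre by an amount that is constant on the fibre, so translation
    invariance in one coordinate suffices. *)
Lemma scales_xshear n (w : E n) : scales 1 (xshear w).
Proof.
apply: (scales_xfiber (g := fun t s => s + dotp w t)) => //.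
- apply: measurable_cons; last exact: measurable_behead.
  apply: measurable_funD; first exact: measurable_tnth.
  by apply: measurableT_comp; [exact: measurable_dotp|exact: measurable_behead].
- by move=> s t; rewrite xshearE.
- by move=> t B mB; rewrite mul1e lebesgue_measure_shift.
Qed.

Lemma scales_yshear n (w : E n) : scales 1 (yshear w).
Proof.
apply: (scales_yfiber (g := fun s => translation (homothety s w))) => //.
- apply: measurable_cons; first exact: measurable_tnth.
  apply: measurable_tuple_fun => i; apply: measurable_funD.
    apply: (measurableT_comp (measurable_tnth _)); exact: measurable_behead.
  rewrite (_ : (fun _ => _) = (fun x => thead x * tnth w i)); last first.
    by apply/funext => x; rewrite tnth_mktuple.
  by apply: measurable_funM => //; exact: measurable_tnth.
- by move=> s t; rewrite yshearE.
- by move=> s; exact: scales_translation.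
Qed.

End volume_scaling.

(** * Rotations of the sphere *)

Section isometries.
Variable R : realType.
Local Notation E n := (euclidean R n).
Local Notation cons n := (@cons_pair _ (measurableTypeR R) n).

(** A representing vector is asked for, rather than additivity and homogeneity, because
    [homog_comp_linmap] takes the coefficients of its polynomials from it. *)
Definition linform n (L : E n -> R) := exists w, L = dotp w.

Lemma linform_tnth n (i : 'I_n) : linform (fun x : E n => tnth x i).
Proof.
exists [tuple (j == i)%:R | j < n]; apply/funext => x.
rewrite /dotp (bigD1 i)//= tnth_mktuple eqxx mul1r big1 ?addr0// => j /negPf ji.
by rewrite tnth_mktuple ji mul0r.
Qed.

Lemma linformD n (L1 L2 : E n -> R) :
  linform L1 -> linform L2 -> linform (fun x => L1 x + L2 x).
Proof.
move=> [u ->] [v ->]; exists (translation v u); apply/funext => x; apply/esym.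
by rewrite /dotp -big_split; apply: eq_bigr => i _; rewrite tnth_mktuple mulrDl.
Qed.

Lemma linformZ n a (L : E n -> R) : linform L -> linform (fun x => a * L x).
Proof.
move=> [u ->]; exists (homothety a u); apply/funext => x.
by rewrite /dotp mulr_sumr; apply: eq_bigr => i _; rewrite tnth_mktuple mulrA.
Qed.

Lemma linform0 n : linform (fun=> 0 : R) (n := n).
Proof.
exists [tuple 0 | i < n]; apply/funext => x.
by rewrite /dotp big1// => i _; rewrite tnth_mktuple mul0r.
Qed.

Lemma linform_sum n (I : Type) (r : seq I) (L : I -> E n -> R) :
  (forall i, linform (L i)) -> linform (fun x => \sum_(i <- r) L i x).
Proof.
move=> hL; elim: r => [|i r IH].
  by under eq_fun do rewrite big_nil; exact: linform0.
by under eq_fun do rewrite big_cons; exact: linformD.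
Qed.

Definition linmap n (f : E n -> E n) := forall i, linform (fun x => tnth (f x) i).

Lemma linform_comp n (L : E n -> R) f : linform L -> linmap f -> linform (L \o f).
Proof.
move=> [w ->] lf; apply: linform_sum => i; exact: linformZ.
Qed.

Lemma linmap_comp n (f g : E n -> E n) : linmap f -> linmap g -> linmap (f \o g).
Proof. by move=> lf lg i; apply: (linform_comp (lf i)). Qed.

Lemma linmap_homothety n (f : E n -> E n) a x : linmap f ->
  f (homothety a x) = homothety a (f x).
Proof.
move=> lf; apply/eq_from_tnth => i; have [w wE] := lf i; rewrite tnth_mktuple.
have -> := congr1 (@^~ (homothety a x)) wE; have -> := congr1 (@^~ x) wE.
rewrite /dotp mulr_sumr; apply: eq_bigr => j _.
by rewrite tnth_mktuple mulrCA.
Qed.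

Lemma sqr_enorm n (x : E n) : enorm x ^+ 2 = dotp x x.
Proof. by rewrite sqr_sqrtr// sumr_ge0// => i _; exact: sqr_ge0. Qed.

Lemma enorm_eq n (x y : E n) : dotp x x = dotp y y -> enorm x = enorm y.
Proof. by rewrite /enorm /dotp => ->. Qed.

Lemma enorm_homothety n a (x : E n) : enorm (homothety a x) = `|a| * enorm x.
Proof.
rewrite /enorm -sqrtr_sqr -sqrtrM ?sqr_ge0// mulr_sumr.
by congr Num.sqrt; apply: eq_bigr => i _; rewrite tnth_mktuple exprMn.
Qed.

Lemma radialE n (x : E n) : radial x = homothety (enorm x)^-1 x.
Proof. by apply/eq_from_tnth => i; rewrite !tnth_mktuple mulrC. Qed.

Lemma homothetyA n a b (x : E n) : homothety a (homothety b x) = homothety (a * b) x.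
Proof. by apply/eq_from_tnth => i; rewrite !tnth_mktuple mulrA. Qed.

Lemma homothety1 n (x : E n) : homothety 1 x = x.
Proof. by apply/eq_from_tnth => i; rewrite !tnth_mktuple mul1r. Qed.

Lemma enorm_radial n (x : E n) : 0 < enorm x -> enorm (radial x) = 1.
Proof.
by move=> x0; rewrite radialE enorm_homothety gtr0_norm ?invr_gt0// mulVf// gt_eqF.
Qed.

Lemma radialK n (x : E n) : 0 < enorm x -> homothety (enorm x) (radial x) = x.
Proof. by move=> x0; rewrite radialE homothetyA divff ?gt_eqF// homothety1. Qed.

Lemma radial_homothety n a (x : E n) : 0 < a -> radial (homothety a x) = radial x.
Proof.
move=> a0; rewrite !radialE enorm_homothety homothetyA gtr0_norm//.
by rewrite invfM mulrAC mulVf ?gt_eqF// mul1r.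
Qed.

(** Volume preservation is a component rather than a consequence of the other two: it is proved for
    shears and passed on to composites, with no determinant. *)
Definition isometry n (f : E n -> E n) :=
  [/\ scales 1 f, linmap f & forall x, enorm (f x) = enorm x].

Lemma isometry_comp n (f g : E n -> E n) :
  isometry f -> isometry g -> isometry (f \o g).
Proof.
move=> [f1 f2 f3] [g1 g2 g3]; split; last by move=> x; rewrite /= f3.
  by rewrite -[1]mulr1; exact: scales_comp.
exact: linmap_comp.
Qed.

Lemma isometry_opp n : isometry (@homothety R n (-1)).
Proof.
split.
- have := @scales_homothety R n (-1); rewrite normrN1 expr1n; apply.
  by rewrite oppr_eq0 oner_eq0.
- move=> i; under eq_fun do rewrite tnth_mktuple.
  by apply: linformZ; exact: linform_tnth.
- by move=> x; rewrite enorm_homothety normrN1 mul1r.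
Qed.

Lemma linmap_xshear n (w : E n) : linmap (xshear w).
Proof.
move=> i; case: (unliftP ord0 i) => [j|] ->.
  under eq_fun do rewrite tnth_consS tnth_behead.
  exact: linform_tnth.
under eq_fun do rewrite tnth_cons0.
apply: linformD; first exact: linform_tnth.
apply: linform_sum => j; apply: linformZ.
under eq_fun do rewrite tnth_behead.
exact: linform_tnth.
Qed.

Lemma linmap_yshear n (w : E n) : linmap (yshear w).
Proof.
move=> i; case: (unliftP ord0 i) => [j|] ->; last first.
  under eq_fun do rewrite tnth_cons0; exact: linform_tnth.
under eq_fun do rewrite tnth_consS !tnth_mktuple tnth_behead mulrC.
apply: linformD; first exact: linform_tnth.
by apply: linformZ; exact: linform_tnth.
Qed.

Lemma dotpC n (u v : E n) : dotp u v = dotp v u.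
Proof. by apply: eq_bigr => i _; rewrite mulrC. Qed.

Lemma dotp0 n (u : E n) : dotp u [tuple 0 | i < n] = 0.
Proof. by rewrite /dotp big1// => i _; rewrite tnth_mktuple mulr0. Qed.

Lemma dotpDl n (u v w : E n) : dotp (translation v u) w = dotp u w + dotp v w.
Proof.
by rewrite /dotp -big_split; apply: eq_bigr => i _; rewrite tnth_mktuple mulrDl.
Qed.

Lemma dotpZl n a (u w : E n) : dotp (homothety a u) w = a * dotp u w.
Proof.
by rewrite /dotp mulr_sumr; apply: eq_bigr => i _; rewrite tnth_mktuple mulrA.
Qed.

Lemma dotp_cons n s t s' t' :
  dotp (cons n (s, t)) (cons n (s', t')) = s * s' + dotp t t'.
Proof.
rewrite /dotp big_ord_recl !tnth_cons0; congr (_ + _).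
by apply: eq_bigr => i _; rewrite !tnth_consS.
Qed.

(* A plane rotation by an angle other than pi is a product of three shears; here
   c and s are the cosine and the sine, and s / (1 + c) is the tangent of the
   half angle. *)
Definition rotation n (c s : R) (u : E n) : E n.+1 -> E n.+1 :=
  xshear (homothety (- (s / (1 + c))) u) \o yshear (homothety s u) \o
  xshear (homothety (- (s / (1 + c))) u).

(** The rotation takes place in the plane of the first axis and the unit vector [u]; the part of [t]
    orthogonal to [u] is fixed, so the tail changes by a multiple of [u]. *)
Lemma rotationE n (c s : R) (u : E n) a t : c ^+ 2 + s ^+ 2 = 1 -> c != -1 ->
  dotp u u = 1 ->
  rotation c s u (cons n (a, t)) = cons n (c * a - s * dotp u t,
    translation (homothety (s * a + (c - 1) * dotp u t) u) t).
Proof.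
move=> cs c1 uu; have c10 : 1 + c != 0 by rewrite addrC addr_eq0.
rewrite -[LHS]/(xshear _ (yshear _ (xshear _ _))) xshearE yshearE xshearE dotpZl.
set p := s / (1 + c); set q := dotp u t.
(* With [p] the tangent of the half angle, this and [p * (1 + c) = s] below are the two half-angle
   identities on which the computation rests. *)
have ps : p * s = 1 - c.
  by rewrite /p mulrAC -expr2 -(addKr (c ^+ 2) (s ^+ 2)) cs; field.
have e : homothety (a + - p * q) (homothety s u) = homothety (s * a + (c - 1) * q) u.
  rewrite homothetyA; congr homothety.
  by transitivity (s * a - (p * s) * q); [ring|rewrite ps; ring].
rewrite e dotpZl dotpC dotpDl dotpC -/q dotpZl uu mulr1.
congr (cons n (_, _)).
have pc : p * (1 + c) = s by rewrite /p mulfVK.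
transitivity (a - (p * s) * a - (p * (1 + c)) * q); first by ring.
by rewrite ps pc; ring.
Qed.

Lemma isometry_rotation n (c s : R) (u : E n) : c ^+ 2 + s ^+ 2 = 1 -> c != -1 ->
  dotp u u = 1 -> isometry (rotation c s u).
Proof.
move=> cs c1 uu; split.
- rewrite -[1]mulr1; apply: scales_comp; last exact: scales_xshear.
  rewrite -[1]mulr1; apply: scales_comp; first exact: scales_xshear.
  exact: scales_yshear.
- apply: linmap_comp; last exact: linmap_xshear.
  by apply: linmap_comp; [exact: linmap_xshear|exact: linmap_yshear].
- move=> x; have [a [t ->]] := euclideanS x; rewrite rotationE//.
  apply: enorm_eq; rewrite !dotp_cons dotpDl dotpZl.
  rewrite ![dotp _ (translation _ _)]dotpC !dotpDl !dotpZl uu dotpC.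
  set q := dotp u t; set r := dotp t t.
  have s2 : s ^+ 2 = 1 - c ^+ 2 by rewrite -cs addrC addKr.
  have -> : dotp t u = q by exact: dotpC.
  transitivity (c ^+ 2 * (a ^+ 2) + s ^+ 2 * q ^+ 2 + r + (s ^+ 2) * a ^+ 2
      + (c ^+ 2 - 1) * q ^+ 2); first by ring.
  by rewrite s2; ring.
Qed.

Lemma dotp_eq0 n (t : E n) : dotp t t = 0 -> forall i, tnth t i = 0.
Proof.
move/eqP; rewrite psumr_eq0; last by move=> i _; rewrite -expr2 sqr_ge0.
by move=> /allP h i; have /eqP/eqP := h i (mem_index_enum i);
  rewrite -expr2 sqrf_eq0 => /eqP.
Qed.

Definition pole n : E n.+1 := cons n (1, [tuple 0 | i < n]).

(** For [x = (c, v)], the angle from the pole has cosine [c] and sine |v|, and the plane of rotation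
    is given by v / |v|. The map back to the pole is the rotation by the opposite angle, so no
    inverse of an isometry has to be formed. *)
Lemma pole_transitive n (x : E n.+1) : enorm x = 1 ->
  exists f g, [/\ isometry f, isometry g, f (pole n) = x & g x = pole n].
Proof.
have [c [v ->]] := euclideanS x => x1.
have cv : c ^+ 2 + dotp v v = 1.
  by rewrite expr2 -dotp_cons -sqr_enorm x1 expr1n.
(* If [v] is null it gives no direction: [x] is the pole or its antipode, and the antipode is at the
   angle pi that the three shears miss. *)
have [v0|v0] := eqVneq (dotp v v) 0.
  have vE : v = [tuple 0 | i < n].
    by apply/eq_from_tnth => i; rewrite tnth_mktuple dotp_eq0.
  move: cv; rewrite v0 addr0 => /eqP; rewrite sqrf_eq1 => /orP[] /eqP cE.
    (* The identity, obtained as the square of the antipodal map. *)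
    have i1 : isometry (@homothety R n.+1 (-1) \o @homothety R n.+1 (-1)).
      by apply: isometry_comp; exact: isometry_opp.
    by do 2 eexists; split; [exact: i1|exact: i1| |];
      rewrite /= homothetyA mulrNN mulr1 homothety1 cE vE.
  have e : homothety (-1) (cons n (c, v)) = pole n.
    apply/eq_from_tnth => i; rewrite tnth_mktuple cE vE.
    case: (unliftP ord0 i) => [j|] ->; last by rewrite !tnth_cons0 mulrNN mulr1.
    by rewrite !tnth_consS tnth_mktuple mulr0.
  exists (homothety (-1)), (homothety (-1)).
  by split; [exact: isometry_opp|exact: isometry_opp|
    rewrite -e homothetyA mulrNN mulr1 homothety1|].
set s := enorm v.
have s0 : 0 < s by rewrite lt_neqAle eq_sym enorm_ge0 andbT -sqrf_eq0 sqr_enorm.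
have ss : s ^+ 2 = dotp v v by rewrite sqr_enorm.
have cs : c ^+ 2 + s ^+ 2 = 1 by rewrite ss.
have cs' : c ^+ 2 + (- s) ^+ 2 = 1 by rewrite sqrrN.
have c1 : c != -1.
  apply/eqP => cE; move/eqP: cs; rewrite cE sqrrN expr1n addrC eq_sym -subr_eq subrr.
  by rewrite eq_sym sqrf_eq0 gt_eqF.
have uu : dotp (radial v) (radial v) = 1 by rewrite -sqr_enorm enorm_radial ?expr1n.
exists (rotation c s (radial v)), (rotation c (- s) (radial v)).
split; [exact: isometry_rotation|exact: isometry_rotation| |];
  rewrite rotationE//; congr (cons n (_, _)).
- by rewrite dotp0 mulr0 subr0 mulr1.
- rewrite dotp0.
  apply/eq_from_tnth => i; rewrite !tnth_mktuple.
  by rewrite mulr0 addr0 mulr1 add0r mulrC divfK// gt_eqF.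
- rewrite radialE dotpZl -ss -cs.
  by rewrite -/s; field; rewrite gt_eqF.
- rewrite radialE dotpZl -ss -/s.
  apply/eq_from_tnth => i; rewrite !tnth_mktuple.
  by field; rewrite gt_eqF.
Qed.

Lemma isometry_transitive n (x y : E n.+1) : enorm x = 1 -> enorm y = 1 ->
  exists2 f, isometry f & f x = y.
Proof.
move=> /pole_transitive[_ [g [_ ig _ gx]]] /pole_transitive[f [_ [jf _ fy _]]].
by exists (f \o g); [exact: isometry_comp|rewrite /= gx].
Qed.

End isometries.

(** * Polar coordinates *)

Section cones.
Variable R : realType.
Local Notation E n := (euclidean R n).
Local Notation vol n := (lebesgue_tuple R n).
Local Notation pb n := (@punctured_ball R n).

Lemma isometry_punctured_ball n (f : E n -> E n) : isometry f ->
  f @^-1` (pb n) = pb n.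
Proof. by move=> [_ _ h]; apply/seteqP; split=> x; rewrite /punctured_ball/= h. Qed.

Lemma isometry_radial n (f : E n -> E n) x : isometry f -> radial (f x) = f (radial x).
Proof. by move=> [_ lf h]; rewrite !radialE linmap_homothety// h. Qed.

(** An isometry commutes with [radial] and preserves the punctured ball, so the cone over the
    preimage of [A] is the preimage of the cone over [A]. *)
Lemma isometry_surface_measure n (f : E n -> E n) A : isometry f -> measurable A ->
  surface_measure (f @^-1` A) = surface_measure A.
Proof.
move=> jf mA; have [[mf vf] _ _] := jf; rewrite /surface_measure.
rewrite -[in RHS]vf ?mul1e; last first.
  apply: measurableI; last exact: measurable_punctured_ball.
  by apply: measurable_preimage => //; exact: measurable_radial.
rewrite preimage_setI isometry_punctured_ball//; congr (_ * vol n (_ `&` _))%E.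
by apply/seteqP; split=> x /=; rewrite isometry_radial.
Qed.

Definition cone n (B : set (E n)) (r : R) : set (E n) :=
  @enorm R n @^-1` `]0, r] `&` @radial R n @^-1` B.

Lemma measurable_cone n (B : set (E n)) r : measurable B -> measurable (cone B r).
Proof.
move=> mB; apply: measurableI.
  by apply: measurable_preimage; [exact: measurable_enorm|exact: measurable_itv].
by apply: measurable_preimage; [exact: measurable_radial|].
Qed.

Lemma punctured_ballE n : pb n = cone setT 1.
Proof.
by apply/seteqP; split=> x; rewrite /punctured_ball /cone/= in_itv//= => -[].
Qed.

(** [radial] ignores positive homotheties, so the homothety of ratio [r^-1] carries one cone to the
    other. *)
Lemma volume_cone n (B : set (E n)) r : 0 < r -> measurable B ->
  vol n (cone B r) = ((r ^+ n)%:E * vol n (cone B 1))%E.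
Proof.
move=> r0 mB; have r1 : r^-1 != 0 by rewrite invr_eq0 gt_eqF.
rewrite -[in RHS](scales_homothety n r1).2; last exact: measurable_cone.
rewrite muleA -EFinM gtr0_norm ?invr_gt0// exprVn divff ?mul1e; last first.
  by rewrite expf_neq0// gt_eqF.
congr (vol n _); apply/seteqP; split=> x; rewrite /cone/= !in_itv/=;
  rewrite enorm_homothety gtr0_norm ?invr_gt0// pmulr_rgt0 ?invr_gt0//;
  by rewrite ler_pdivrMl// mulr1 radial_homothety ?invr_gt0.
Qed.

Definition box n (A : set R) : set (E n) := [set x | forall i, A (tnth x i)].

Arguments box : clear implicits.

Lemma measurable_box n (A : set R) : measurable A -> measurable (box n A).
Proof.
move=> mA; have -> : box n A = \big[setI/setT]_(i < n) (fun x => tnth x i) @^-1` A.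
  rewrite -bigcap_seq; apply/seteqP; split=> x h i; first by move=> _; exact: h.
  by apply: h; rewrite /= mem_index_enum.
apply: bigsetI_measurable => i _.
by apply: measurable_preimage => //; exact: measurable_tnth.
Qed.

Lemma volume_box n (A : set R) : measurable A ->
  vol n (box n A) = (@lebesgue_measure R A ^+ n)%E.
Proof.
move=> mA; elim: n => [|n IH].
  by rewrite /= diracE mem_set// => -[].
rewrite expeS -IH -product_measure1E//; last exact: measurable_box.
rewrite /= /cons_measure /pushforward; congr product_measure1.
apply/seteqP; split=> -[s t] /=.
  move=> h; split; first exact: (h ord0).
  by move=> i; have := h (lift ord0 i); rewrite tnth_consS.
move=> [As At] i; case: (unliftP ord0 i) => [j|] -> //.
by rewrite tnth_consS; exact: At.
Qed.

Lemma volume_box_itv n (a b : R) : a < b ->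
  vol n (box n `]a, b]%classic) = ((b - a) ^+ n)%:E.
Proof.
by move=> ab; rewrite volume_box// lebesgue_measure_itv/= lte_fin ab -EFinD EFin_expe.
Qed.

Lemma tnth_le_enorm n (x : E n) i : `|tnth x i| <= enorm x.
Proof.
rewrite -sqrtr_sqr ler_sqrt; last by apply: sumr_ge0 => j _; exact: sqr_ge0.
by rewrite (bigD1 i)//= lerDl sumr_ge0// => j _; exact: sqr_ge0.
Qed.

Lemma measurable_unit_ball n : measurable (@unit_ball R n).
Proof.
rewrite (_ : unit_ball = @enorm R n @^-1` `]-oo, 1]%classic).
  by apply: measurable_preimage; [exact: measurable_enorm|exact: measurable_itv].
by apply/seteqP; split => x /=; rewrite in_itv.
Qed.

Lemma measurable_unit_sphere n : measurable (@unit_sphere R n).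
Proof.
rewrite (_ : unit_sphere = @enorm R n @^-1` [set 1]).
  by apply: measurable_preimage; [exact: measurable_enorm|exact: measurable_set1].
by apply/seteqP; split => x.
Qed.

Lemma volume_unit_ball_lty n : (vol n (@unit_ball R n) < +oo)%E.
Proof.
(* The interval []-1, 1]] would lose the points with a coordinate equal to -1. *)
apply: (@le_lt_trans _ _ (vol n (box n `](-2), 2]%classic))); last first.
  by rewrite volume_box_itv ?ltry//; lra.
apply: le_measure; rewrite ?inE.
- exact: measurable_unit_ball.
- by apply: measurable_box; exact: measurable_itv.
- move=> x /= x1 i; rewrite /= in_itv/=.
  have := le_trans (tnth_le_enorm x i) x1; rewrite ler_norml => /andP[? ?].
  by apply/andP; split; lra.
Qed.

Lemma volume_cone_lty n (B : set (E n)) : measurable B ->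
  (vol n (cone B 1) < +oo)%E.
Proof.
move=> mB; apply: le_lt_trans (volume_unit_ball_lty n).
apply: le_measure; rewrite ?inE; [exact: measurable_cone|exact: measurable_unit_ball|].
by move=> x []; rewrite /= in_itv/= => /andP[].
Qed.

Lemma volume_cone_fin n (B : set (E n)) : measurable B ->
  vol n (cone B 1) \is a fin_num.
Proof. by move=> mB; rewrite ge0_fin_numE ?measure_ge0// volume_cone_lty. Qed.

(** If the punctured ball were null, so would be its dilates; but the one of radius [n + 1] contains
    the unit cube. *)
Lemma volume_punctured_ball_gt0 n : (0 < n)%N -> (0 < vol n (pb n))%E.
Proof.
move=> n0; rewrite lt0e measure_ge0 andbT; apply/eqP => v0.
have a0 : 0 < n.+1%:R :> R by [].
have : (vol n (box n `]0%R, 1%R]%classic) <= vol n (cone setT n.+1%:R))%E.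
  apply: le_measure; rewrite ?inE; [|exact: measurable_cone|].
    by apply: measurable_box; exact: measurable_itv.
  move=> x h; split=> //=; rewrite in_itv/=; apply/andP; split.
    have := h (Ordinal n0); rewrite /= in_itv/= => /andP[x0 _].
    apply: lt_le_trans x0 _; apply: le_trans (tnth_le_enorm _ _); exact: ler_norm.
  rewrite -(@ger0_norm _ n.+1%:R)// -sqrtr_sqr ler_sqrt ?sqr_ge0//.
  apply: (@le_trans _ _ (\sum_(i < n) 1)).
    apply: ler_sum => i _; have := h i; rewrite /= in_itv/= => /andP[? ?].
    by rewrite expr_le1// ltW.
  rewrite sumr_const card_ord -natrX ler_nat.
  by rewrite (leq_trans (leqnSn n))// leq_pmulr.
rewrite volume_cone// -punctured_ballE v0 mule0 volume_box_itv// subr0 expr1n.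
by rewrite lee_fin ler10.
Qed.

(** Doubling fixes this set and multiplies volumes by 2 ^ n > 1, so its finite volume must be 0. *)
Lemma volume_origin n : (0 < n)%N -> vol n [set x | enorm x = 0] = 0%E.
Proof.
move=> n0; set O := [set x | _].
have mO : measurable O.
  rewrite (_ : O = @enorm R n @^-1` [set 0])//.
  by apply: measurable_preimage; [exact: measurable_enorm|exact: measurable_set1].
have fO : vol n O \is a fin_num.
  rewrite ge0_fin_numE ?measure_ge0//; apply: le_lt_trans (volume_unit_ball_lty n).
  apply: le_measure; rewrite ?inE//; first exact: measurable_unit_ball.
  by move=> x /= x0; rewrite /unit_ball/= x0.
have two0 : 2 != 0 :> R by rewrite pnatr_eq0.
have := (scales_homothety n two0).2 O mO.
have -> : homothety 2 @^-1` O = O.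
  apply/seteqP; split=> x; rewrite /O/= enorm_homothety ger0_norm//.
    by move=> /eqP; rewrite mulf_eq0 (negPf two0) => /eqP.
  by move=> ->; rewrite mulr0.
move: fO => /fineK <-; rewrite -EFinM ger0_norm// => -[] /eqP.
rewrite -subr_eq0 -{2}[fine _]mul1r -mulrBl mulf_eq0 subr_eq0 => /orP[|/eqP->//].
by rewrite gt_eqF// exprn_egt1 -?lt0n// ltr1n.
Qed.

Lemma onem_expr_le n (r : R) : 0 <= r -> r <= 1 -> 1 - r ^+ n <= n%:R * (1 - r).
Proof.
move=> r0 r1; elim: n => [|n IH]; first by rewrite expr0 subrr mul0r.
have -> : 1 - r ^+ n.+1 = (1 - r ^+ n) + r ^+ n * (1 - r) by rewrite exprS; ring.
rewrite -natr1 mulrDl mul1r lerD// ler_piMl ?subr_ge0// exprn_ile1//.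
Qed.

(** The sphere lies in every shell between the radii [r < 1] and 1, of volume [(1 - r ^+ n) * v],
    which tends to 0 as [r] tends to 1. *)
Lemma volume_unit_sphere n : vol n (@unit_sphere R n) = 0%E.
Proof.
set v := fine (vol n (cone setT 1)).
have vE : vol n (cone setT 1) = v%:E by rewrite fineK// volume_cone_fin.
have v0 : 0 <= v by rewrite fine_ge0// measure_ge0.
have le r : 0 < r < 1 -> (vol n (@unit_sphere R n) <= ((1 - r ^+ n) * v)%:E)%E.
  move=> /andP[r0 r1].
  have -> : ((1 - r ^+ n) * v)%:E = vol n (cone setT 1 `\` cone setT r).
    rewrite measureD//=; [|exact: measurable_cone|exact: measurable_cone|].
      rewrite setIidr; first by rewrite (volume_cone r0)//= vE -EFinM mulrBl mul1r EFinB.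
      move=> x []; rewrite /cone/= !in_itv/= => /andP[-> xr _]; split=> //=.
      by rewrite (le_trans xr)// ltW.
    exact: volume_cone_lty.
  apply: le_measure; rewrite ?inE; first exact: measurable_unit_sphere.
    by apply: measurableD; exact: measurable_cone.
  move=> x /= x1; rewrite /cone/= !in_itv/= x1 ltr01 lexx; split=> // -[].
  by rewrite leNgt r1.
apply/eqP; rewrite eq_le measure_ge0 andbT.
apply/lee_addgt0Pr => e e0; rewrite add0e.
(* By [onem_expr_le], a form of Bernoulli's inequality, the shell then has volume at most [e]. The
   [+ 1] keeps the denominator positive when [v = 0], and the maximum keeps [r] positive. *)
pose r := Num.max 2^-1 (1 - e / (n%:R * v + 1)).
have D0 : 0 < n%:R * v + 1 by rewrite ltr_wpDl// mulr_ge0.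
have eD : 0 < e / (n%:R * v + 1) by rewrite divr_gt0.
have r01 : 0 < r < 1.
  by rewrite /r lt_max gt_max invr_gt0 ltr0n/= invf_lt1 ?ltr1n//=; lra.
apply: le_trans (le _ r01) _; rewrite lee_fin.
have [r0 r1] := andP r01.
have bern := onem_expr_le n (ltW r0) (ltW r1).
apply: (@le_trans _ _ (n%:R * (1 - r) * v)); first exact: ler_wpM2r.
have rE : 1 - r <= e / (n%:R * v + 1).
  by rewrite lerBlDl -lerBlDr le_max lexx orbT.
apply: (@le_trans _ _ (n%:R * v * (e / (n%:R * v + 1)))).
  by rewrite mulrAC ler_wpM2l// mulr_ge0.
by rewrite mulrCA ler_piMr ?(ltW e0)// ler_pdivrMr// mul1r lerDl.
Qed.

End cones.

Lemma ge0_integral_mrestr d (T : measurableType d) (R : realType)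
    (m : {measure set T -> \bar R}) (D : set T) (mD : measurable D) (f : T -> \bar R) :
  measurable_fun setT f -> (forall x, 0 <= f x)%E ->
  (\int[mrestr m mD]_x f x = \int[m]_(x in D) f x)%E.
Proof.
move=> mf f0; have mDC := measurableC mD.
rewrite [LHS](ge0_negligible_integral mDC)//; last first.
  by rewrite /= /mrestr setICl measure0.
rewrite setTD setCK; apply: eq_measure_integral => A mA AD.
by rewrite /= /mrestr setIidl.
Qed.

Section polar_coordinates.
Variables (R : realType) (n : nat).
Hypothesis n0 : (0 < n)%N.
Local Notation E := (euclidean R n).
Local Notation vol := (lebesgue_tuple R n).
Local Notation pb := (@punctured_ball R n).

Let restricted : {measure set E -> \bar R} :=
  mrestr vol (@measurable_punctured_ball R n).

Let polar (x : E) : measurableTypeR R * E := (enorm x, radial x).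

Let measurable_polar : measurable_fun setT polar.
Proof.
by apply/measurable_fun_pairP; split; [exact: measurable_enorm|exact: measurable_radial].
Qed.

(** The three laws are not normalized: their total mass is [ballvol], whence the factors [ballvol]
    and [vol pb] in the product formulas. *)
Let radius_law : set (measurableTypeR R) -> \bar R :=
  pushforward restricted (@enorm R n : E -> measurableTypeR R).

HB.instance Definition _ := Measure.copy radius_law
  (measure_function_pushforward__canonical__measure_function_Measure
    restricted (@measurable_enorm R n : measurable_fun setT (@enorm R n : E -> measurableTypeR R))).

Let direction_law : set E -> \bar R := pushforward restricted (@radial R n).

HB.instance Definition _ := Measure.copy direction_law
  (measure_function_pushforward__canonical__measure_function_Measure
    restricted (@measurable_radial R n)).

Let joint_law : set (measurableTypeR R * E) -> \bar R := pushforward restricted polar.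

HB.instance Definition _ := Measure.copy joint_law
  (measure_function_pushforward__canonical__measure_function_Measure
    restricted measurable_polar).

Let restricted_fin A : measurable A -> restricted A \is a fin_num.
Proof.
move=> mA; rewrite ge0_fin_numE ?measure_ge0//.
apply: (@le_lt_trans _ _ (vol (cone setT 1))); last exact: volume_cone_lty.
rewrite -punctured_ballE; apply: le_measure; rewrite ?inE.
- by apply: measurableI => //; exact: measurable_punctured_ball.
- exact: measurable_punctured_ball.
- by move=> x [].
Qed.

Let radius_fin : fin_num_fun radius_law.
Proof.
move=> A mA; apply: restricted_fin.
by apply: measurable_preimage => //; exact: measurable_enorm.
Qed.

HB.instance Definition _ := Measure_isFinite.Build _ _ _ radius_law radius_fin.

Let direction_fin : fin_num_fun direction_law.
Proof.
move=> A mA; apply: restricted_fin.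
by apply: measurable_preimage => //; exact: measurable_radial.
Qed.

HB.instance Definition _ := Measure_isFinite.Build _ _ _ direction_law direction_fin.

Let ballvol : {nonneg R} := NngNum (fine_ge0 (measure_ge0 vol (cone setT 1))).

(** Radii on the punctured ball lie in []0, 1]]; clamping the ends of an arbitrary interval leaves
    its trace there unchanged. *)
Let clamp (r : R) := Num.max 0 (Num.min 1 r).

Let cone0 B : cone B 0 = set0 :> set E.
Proof. by apply/seteqP; split=> // x []; rewrite /= in_itv/= => /andP[x0]; rewrite leNgt x0. Qed.

Let volume_cone_ge0 (B : set E) r : 0 <= r -> measurable B ->
  vol (cone B r) = ((r ^+ n)%:E * vol (cone B 1))%E.
Proof.
rewrite le_eqVlt => /predU1P[<- _|]; last exact: volume_cone.
by rewrite cone0 measure0 expr0n gtn_eqF// mul0e.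
Qed.

Let le_clamp e r : 0 < e -> e <= 1 -> (e <= clamp r) = (e <= r).
Proof. by move=> e0 e1; rewrite /clamp le_max (lt_geF e0)/= le_min e1. Qed.

(** The points with direction in [B] and radius in []a, b]] form a difference of two cones, and the
    scaling of cones extracts the radial factor. *)
Let joint_itv (B : set E) a b : measurable B -> a < b ->
  joint_law (`]a, b]%classic `*` B) =
  ((clamp b ^+ n - clamp a ^+ n)%:E * direction_law B)%E.
Proof.
move=> mB ab.
have c0 r : 0 <= clamp r by rewrite le_max lexx.
have c1 r : clamp r <= 1 by rewrite ge_max ler01 ge_min lexx.
have cab : clamp a <= clamp b.
  by rewrite /clamp le_max2//; rewrite le_min2// ltW.
have -> : direction_law B = vol (cone B 1).
  rewrite /direction_law /pushforward/= /mrestr; congr (vol _).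
  by rewrite punctured_ballE /cone setIC preimage_setT setIT.
transitivity (vol (cone B (clamp b) `\` cone B (clamp a))).
  rewrite /joint_law /pushforward/= /mrestr; congr (vol _).
  apply/seteqP; split=> x; rewrite /cone/= /punctured_ball/= !in_itv/=.
    move=> [[/andP[ax xb] Bx] /andP[x0 x1]]; rewrite x0 !le_clamp//; split=> //.
    by move=> [/= xa _]; move: ax; rewrite ltNge xa.
  move=> [[/andP[x0 xb] Bx] xa].
  have x1 := le_trans xb (c1 b); rewrite x0 x1; split=> //; split=> //.
  rewrite le_clamp// in xb; rewrite xb andbT ltNge; apply/negP => xa'.
  by apply: xa; rewrite x0 le_clamp.
rewrite measureD; [|exact: measurable_cone|exact: measurable_cone|].
  rewrite setIidr.
    rewrite /= (volume_cone_ge0 (c0 a) mB) (volume_cone_ge0 (c0 b) mB).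
    rewrite -(fineK (volume_cone_fin mB)) -!EFinM -EFinB.
    by rewrite mulrBl.
  move=> x []; rewrite /cone/= !in_itv/= => /andP[-> xa] Bx; split=> //=.
  exact: le_trans xa cab.
by rewrite /= volume_cone_ge0// lte_mul_pinfty ?lee_fin ?exprn_ge0// volume_cone_lty.
Qed.

(** For fixed [B] both sides are finite measures in [A]; they agree on half-open intervals by
    [joint_itv], hence everywhere. *)
Let joint_prod A B : measurable A -> measurable B ->
  (ballvol%:num%:E * joint_law (A `*` B) = radius_law A * direction_law B)%E.
Proof.
move=> mA mB.
have mrB : measurable (@radial R n @^-1` B).
  by apply: measurable_preimage => //; exact: measurable_radial.
pose slice := measure_function_pushforward__canonical__measure_function_Measure
  (mrestr restricted mrB)
  (@measurable_enorm R n : measurable_fun setT (@enorm R n : E -> measurableTypeR R)).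
pose m1 : {measure set (measurableTypeR R) -> \bar R} := mscale ballvol slice.
pose dB : {nonneg R} := NngNum (fine_ge0 (measure_ge0 direction_law B)).
have dBE : direction_law B = dB%:num%:E by rewrite /= fineK// direction_fin.
pose m2 : {measure set (measurableTypeR R) -> \bar R} := mscale dB radius_law.
have jT C : joint_law (setT `*` C) = direction_law C.
  by rewrite /joint_law /direction_law /pushforward; congr (restricted _);
    apply/seteqP; split=> x //= [].
have rE C : radius_law C = joint_law (C `*` setT).
  by rewrite /joint_law /radius_law /pushforward; congr (restricted _);
    apply/seteqP; split=> x //= [].
have dT : direction_law setT = ballvol%:num%:E.
  rewrite /= fineK ?volume_cone_fin// /direction_law /pushforward/= /mrestr.
  by rewrite preimage_setT setTI punctured_ballE.
rewrite dBE muleC [RHS]muleC [LHS]muleC.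
rewrite -[LHS]/(m1 A) -[RHS]/(m2 A).
apply: (@measure_unique _ R (measurableTypeR R) (@ocitv R)
  (fun k => `](- k%:R), k%:R]%classic) _ _ _ _ m1 m2).
- reflexivity.
- exact: ocitvI.
- by move=> k; exists (- k%:R, k%:R).
- rewrite -subTset => r _; exists (Num.truncn `|r|).+1 => //=; rewrite in_itv/=.
  by have := truncnS_gt `|r|; rewrite ltr_norml => /andP[-> /ltW].
- move=> _ /ocitvP[->|[[a b] /= ab ->]]; first by rewrite !measure0.
  rewrite -[LHS]/(ballvol%:num%:E * joint_law (`]a, b]%classic `*` B))%E.
  rewrite -[RHS]/(dB%:num%:E * radius_law `]a, b]%classic)%E rE !joint_itv//.
  by rewrite dT dBE muleCA [RHS]muleCA; congr (_ * _)%E; rewrite muleC.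
- move=> k.
  have mk : measurable (@enorm R n @^-1` `](- k%:R)%R, k%:R]%classic `&`
      @radial R n @^-1` B).
    apply: measurableI => //.
    by apply: measurable_preimage; [exact: measurable_enorm|exact: measurable_itv].
  have h : (ballvol%:num%:E * restricted (@enorm R n @^-1` `](- k%:R)%R, k%:R]%classic `&`
      @radial R n @^-1` B) < +oo)%E.
    by rewrite ltey_eq fin_numM// restricted_fin.
  exact: h.
- exact: mA.
Qed.

(* On the punctured ball the radius and the direction are independent, because
   homotheties multiply the volume of all the cones by the same factor. *)
Lemma polar_integral (g : R -> \bar R) (h : E -> \bar R) :
  measurable_fun [set: measurableTypeR R] g -> (forall r, 0 <= g r)%E ->
  measurable_fun setT h -> (forall x, 0 <= h x)%E ->
  (vol pb * \int[vol]_(x in pb) (g (enorm x) * h (radial x)) =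
   (\int[vol]_(x in pb) g (enorm x)) * \int[vol]_(x in pb) h (radial x))%E.
Proof.
move=> mg g0 mh h0.
have mpb := @measurable_punctured_ball R n.
have volE : vol pb = ballvol%:num%:E.
  by rewrite /= fineK ?volume_cone_fin// punctured_ballE.
have mF : measurable_fun setT (fun z : measurableTypeR R * E => g z.1 * h z.2)%E.
  apply: emeasurable_funM.
    exact: (measurableT_comp mg measurable_fst).
  exact: (measurableT_comp mh measurable_snd).
have jE X : measurable X ->
    (radius_law \x direction_law)%E X = mscale ballvol joint_law X.
  apply: product_measure_unique => A B mA mB.
  by rewrite -joint_prod.
have -> : (\int[vol]_(x in pb) g (enorm x) = \int[radius_law]_r g r)%E.
  rewrite -(ge0_integral_mrestr vol mpb)//; last first.
    exact: (measurableT_comp mg (@measurable_enorm R n)).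
  rewrite [RHS]ge0_integral_pushforward//; exact: measurable_enorm.
have -> : (\int[vol]_(x in pb) h (radial x) = \int[direction_law]_r h r)%E.
  rewrite -(ge0_integral_mrestr vol mpb)//; last first.
    exact: (measurableT_comp mh (@measurable_radial R n)).
  rewrite [RHS]ge0_integral_pushforward//; exact: measurable_radial.
transitivity (\int[radius_law \x direction_law]_z (g z.1 * h z.2))%E.
  rewrite (eq_measure_integral (mscale ballvol joint_law)); last first.
    by move=> A mA _; exact: jE.
  rewrite ge0_integral_mscale//; last by move=> z _; exact: mule_ge0.
  rewrite volE; congr (_ * _)%E.
  rewrite -(ge0_integral_mrestr vol mpb)//; last 2 first.
    exact: (measurableT_comp mF measurable_polar).
    by move=> x; exact: mule_ge0.
  by rewrite [RHS]ge0_integral_pushforward// => z _; exact: mule_ge0.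
rewrite fubini_tonelli1//=; last by move=> z; exact: mule_ge0.
rewrite /fubini_F/=.
under eq_integral do rewrite ge0_integralZl//.
by rewrite ge0_integralZr// integral_ge0.
Qed.

End polar_coordinates.

(** * Means over the sphere and the ball *)

Local Notation homog m := (mpoly.ishomog1 m mpoly.mdeg).

Section polynomial_evaluation.
Variables (R : realType) (d : nat).
Local Notation E := (euclidean R d).
Implicit Types (p q : mpoly.mpoly d R) (x : E).

Lemma pevalE p x : peval p x =
  \sum_(m <- mpoly.msupp p) mpoly.mcoeff m p * \prod_i tnth x i ^+ m i.
Proof. exact: mpoly.mevalE. Qed.

Lemma measurable_peval p : measurable_fun [set: E] (peval p).
Proof.
rewrite (funext (pevalE p)).
apply: measurable_sum => m; apply: measurable_funM => //.
apply: measurable_prod => i _; apply: measurable_funX; exact: measurable_tnth.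
Qed.

Lemma bounded_peval p : exists2 M, 0 <= M & forall x, enorm x <= 1 -> `|peval p x| <= M.
Proof.
exists (\sum_(m <- mpoly.msupp p) `|mpoly.mcoeff m p|); first exact: sumr_ge0.
move=> x x1; rewrite pevalE (le_trans (ler_norm_sum _ _ _))//.
apply: ler_sum => m _; rewrite normrM ler_piMr// normr_prod.
apply: prodr_ile1 => i _; rewrite normr_ge0/= normrX exprn_ile1//.
exact: le_trans (tnth_le_enorm x i) x1.
Qed.

Lemma peval_homothety m p a x : p \is homog m ->
  peval p (homothety a x) = a ^+ m * peval p x.
Proof.
move=> hp; rewrite !pevalE mulr_sumr !big_seq; apply: eq_bigr => k kp.
have mk : mpoly.mdeg k = m := mpoly.dhomog_mf hp kp.
rewrite mulrCA; congr (_ * _); rewrite -mk mpoly.mdegE.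
rewrite -prodrXr -big_split/=; apply: eq_bigr => i _.
by rewrite tnth_mktuple exprMn.
Qed.

Lemma pevalD p q x : peval (p + q) x = peval p x + peval q x.
Proof. exact: mpoly.mevalD. Qed.

Lemma pevalZ c p x : peval (c *: p) x = c * peval p x.
Proof. exact: mpoly.mevalZ. Qed.

Lemma pevalM p q x : peval (p * q) x = peval p x * peval q x.
Proof. exact: mpoly.mevalM. Qed.

Lemma pevalX p j x : peval (p ^+ j) x = peval p x ^+ j.
Proof. exact: (rmorphXn (mpoly.meval (tnth x))). Qed.

Lemma peval1 x : peval 1 x = 1.
Proof. exact: mpoly.meval1. Qed.

Lemma peval_sum (I : Type) (r : seq I) (F : I -> mpoly.mpoly d R) x :
  peval (\sum_(i <- r) F i) x = \sum_(i <- r) peval (F i) x.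
Proof. exact: (raddf_sum (mpoly.meval (tnth x))). Qed.

End polynomial_evaluation.

Section sphere_average.
Variables (R : realType) (d : nat).
Hypothesis d0 : (0 < d)%N.
Local Notation E := (euclidean R d).
Local Notation vol := (lebesgue_tuple R d).
Local Notation pb := (@punctured_ball R d).
Local Notation S := (@unit_sphere R d).
Local Notation sigma := (@surface_measure R d).
Implicit Types (p q : mpoly.mpoly d R) (x : E).

Lemma radial_preimage_sphere : @radial R d @^-1` S `&` pb = pb.
Proof.
apply/seteqP; split=> [x []//|x x1]; split=> //.
by rewrite /unit_sphere/= enorm_radial//; case/andP: x1.
Qed.

Lemma surface_measure_sphere : sigma S = (d%:R%:E * vol pb)%E.
Proof. by rewrite /surface_measure radial_preimage_sphere. Qed.

Lemma volume_punctured_ball_fin : vol pb \is a fin_num.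
Proof. by rewrite punctured_ballE volume_cone_fin. Qed.

Lemma surface_measure_fin : sigma S \is a fin_num.
Proof. by rewrite surface_measure_sphere fin_numM// volume_punctured_ball_fin. Qed.

Lemma surface_measure_lty : (sigma S < +oo)%E.
Proof. by rewrite -ge0_fin_numE ?measure_ge0// surface_measure_fin. Qed.

Lemma sphere_areaE : sphere_area R d = fine (sigma S).
Proof. by rewrite /sphere_area Rintegral_cst ?mul1r//; exact: measurable_unit_sphere. Qed.

Lemma surface_measure_gt0 : (0 < sigma S)%E.
Proof.
rewrite surface_measure_sphere mule_gt0 ?lte_fin ?ltr0n//.
exact: volume_punctured_ball_gt0.
Qed.

Lemma sphere_area_gt0 : 0 < sphere_area R d.
Proof.
by rewrite sphere_areaE fine_gt0// surface_measure_lty surface_measure_gt0.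
Qed.

Lemma integrable_sphere p : sigma.-integrable S (EFin \o peval p).
Proof.
apply: measurable_bounded_integrable.
- exact: measurable_unit_sphere.
- exact: surface_measure_lty.
- by apply: measurable_funTS; exact: measurable_peval.
- have [M M0 pM] := bounded_peval p.
  exists M; split=> [|y My]; first exact: num_real.
  move=> x Sx; apply: le_trans (ltW My); apply: pM.
  by rewrite /unit_sphere/= in Sx; rewrite Sx.
Qed.

Definition sphere_mean p : R :=
  (sphere_area R d)^-1 * \int[sigma]_(x in S) peval p x.

Lemma sphere_mean_linear : linear_for *%R sphere_mean.
Proof.
move=> c p q; rewrite /sphere_mean.
have mS := @measurable_unit_sphere R d.
under eq_Rintegral do rewrite pevalD pevalZ.
rewrite RintegralD//; last 2 first.
- by rewrite -(funext (pevalZ c p)); exact: integrable_sphere.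
- exact: integrable_sphere.
by rewrite RintegralZl//; [ring|exact: integrable_sphere].
Qed.

HB.instance Definition _ := GRing.isLinear.Build R (mpoly.mpoly d R) R *%R
  sphere_mean sphere_mean_linear.

Lemma sphere_meanD p q : sphere_mean (p + q) = sphere_mean p + sphere_mean q.
Proof. exact: linearD. Qed.

Lemma sphere_meanZ c p : sphere_mean (c *: p) = c * sphere_mean p.
Proof. exact: linearZ. Qed.

Lemma sphere_mean_sum (I : Type) (r : seq I) (F : I -> mpoly.mpoly d R) :
  sphere_mean (\sum_(i <- r) F i) = \sum_(i <- r) sphere_mean (F i).
Proof. exact: linear_sum. Qed.

Lemma eq_sphere_mean p q : (forall x, S x -> peval p x = peval q x) ->
  sphere_mean p = sphere_mean q.
Proof.
move=> pq; congr (_ * _); apply: eq_Rintegral => x /set_mem; exact: pq.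
Qed.

Lemma sphere_mean1 : sphere_mean 1 = 1.
Proof.
rewrite /sphere_mean; under eq_Rintegral do rewrite peval1.
by rewrite -/(sphere_area R d) mulVf// gt_eqF// sphere_area_gt0.
Qed.

Lemma sphere_mean_ge0 p : (forall x, S x -> 0 <= peval p x) -> 0 <= sphere_mean p.
Proof.
move=> p0; rewrite mulr_ge0 ?invr_ge0 ?(ltW sphere_area_gt0)//.
exact: Rintegral_ge0.
Qed.

(** Such a polynomial vanishes almost everywhere on the sphere, which has positive measure. One zero
    is enough for [gram_unit], where isometries move it around. *)
Lemma sphere_mean_eq0 p : (forall x, S x -> 0 <= peval p x) -> sphere_mean p = 0 ->
  exists2 x, S x & peval p x = 0.
Proof.
move=> p0 /eqP; rewrite mulf_eq0 invr_eq0 gt_eqF ?sphere_area_gt0//= => /eqP I0.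
have mS := @measurable_unit_sphere R d.
apply: contrapT => nex.
have : (\int[sigma]_(x in S) `|(peval p x)%:E| = 0)%E.
  under eq_integral => x /set_mem Sx do rewrite gee0_abs ?lee_fin ?p0//.
  by rewrite -[LHS]fineK ?(congr1 EFin I0)//; exact: integrable_fin_num (integrable_sphere p).
move/ae_eq_integral_abs => /(_ mS) [].
  by apply/measurable_EFinP/measurable_funTS; exact: measurable_peval.
move=> N [mN N0 sN].
have SN : S `<=` N.
  move=> x Sx; apply: sN => /= /(_ Sx) [] px0; apply: nex; by exists x.
have := surface_measure_gt0; rewrite lt0e => /andP[/eqP + _]; apply.
by apply: (subset_measure0 _ _ _ N0).
Qed.

(** Change of variables for the pushforward by [f]. The composite of [p] and [f] enters as a
    polynomial [q] with the same values, because [sphere_mean] takes polynomials only. *)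
Lemma sphere_mean_isometry (f : E -> E) p q : isometry f ->
  (forall x, peval q x = peval p (f x)) -> sphere_mean q = sphere_mean p.
Proof.
move=> jf qp; congr (_ * fine _); have [[mf _] _ nf] := jf.
have mS := @measurable_unit_sphere R d.
have fS : f @^-1` S = S by apply/seteqP; split=> x; rewrite /unit_sphere/= nf.
under eq_integral do rewrite qp.
rewrite -[in LHS]fS -(@integral_pushforward _ _ _ _ _ f mf sigma S (EFin \o peval p))//.
- by apply: eq_measure_integral => A mA _; exact: isometry_surface_measure.
- by apply/measurable_EFinP; exact: measurable_peval.
- have := integrable_sphere q; rewrite fS.
  by congr (is_true (_.-integrable _ _)); apply/funext => x /=; rewrite qp.
Qed.

End sphere_average.

Lemma measurable_fun_powRl d (T : measurableType d) (R : realType) (f : T -> R) a :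
  measurable_fun setT f -> measurable_fun setT (fun x => f x `^ a).
Proof.
move=> mf; rewrite (_ : (fun x => _) = (fun r : R => r `^ a) \o f)//.
by apply: measurableT_comp; first exact: measurable_powR.
Qed.

Section ball_mean.
Variables (R : realType) (d : nat) (mu : R).
Hypothesis d0 : (0 < d)%N.
Local Notation E := (euclidean R d).
Local Notation vol := (lebesgue_tuple R d).
Local Notation pb := (@punctured_ball R d).
Local Notation B := (@unit_ball R d).
Local Notation S := (@unit_sphere R d).
Local Notation sigma := (@surface_measure R d).
Local Notation w := (@weight R d mu).
Implicit Types (p q : mpoly.mpoly d R) (x : E).

Lemma measurable_weight : measurable_fun setT w.
Proof.
apply: measurable_fun_powRl.
by apply: measurable_funB => //; apply: measurable_funX; exact: measurable_enorm.
Qed.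

Lemma weight_ge0 x : 0 <= w x.
Proof. exact: powR_ge0. Qed.

(* When the weight is not integrable, Rintegral returns the junk value 0, and
   weight_mass^-1 = 0 makes every ball_mean vanish. All statements below survive
   this case, so that the integrability of the weight is never needed. *)
Lemma weight_mass_eq0 : ~ vol.-integrable B (EFin \o w) -> weight_mass d mu = 0.
Proof.
move=> ni; rewrite /weight_mass /Rintegral.
suff -> : (\int[vol]_(x in B) (w x)%:E = +oo)%E by [].
apply/eqP; rewrite -leye_eq leNgt; apply/negP => lt; apply: ni.
apply/integrableP; split.
  by apply/measurable_EFinP/measurable_funTS; exact: measurable_weight.
by under eq_integral do rewrite /= ger0_norm ?weight_ge0//.
Qed.

Definition ball_mean p : R :=
  (weight_mass d mu)^-1 * \int[vol]_(x in B) (peval p x * w x).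

Definition radial_moment m : R :=
  (weight_mass d mu)^-1 * \int[vol]_(x in B) (enorm x ^+ m * w x).

Lemma bounded_integrable_weight (h : E -> R) (M : R) :
  vol.-integrable B (EFin \o w) -> measurable_fun setT h ->
  (forall x, enorm x <= 1 -> `|h x| <= M) ->
  vol.-integrable B (EFin \o (fun x => h x * w x)).
Proof.
move=> iw mh hM; rewrite (_ : EFin \o _ = (EFin \o h) \* (EFin \o w))%E//.
apply: integrableMr => //; first exact: measurable_unit_ball.
- exact: measurable_funTS.
- exists M; split=> [|y My]; first exact: num_real.
  by move=> x Bx; apply: le_trans (ltW My); exact: hM.
Qed.

Lemma integrable_peval_weight p : vol.-integrable B (EFin \o w) ->
  vol.-integrable B (EFin \o (fun x => peval p x * w x)).
Proof.
move=> iw; have [M _ pM] := bounded_peval p.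
by apply: bounded_integrable_weight pM => //; exact: measurable_peval.
Qed.

Lemma ball_mean_linear : linear_for *%R ball_mean.
Proof.
move=> c p q; rewrite /ball_mean.
have [iw|/weight_mass_eq0->] := pselect (vol.-integrable B (EFin \o w)); last first.
  by rewrite invr0; ring.
have mB := @measurable_unit_ball R d.
have -> : (fun x => peval (c *: p + q) x * w x) =
    (fun x => c * (peval p x * w x) + peval q x * w x).
  by apply/funext => x; rewrite pevalD pevalZ; ring.
rewrite RintegralD//; last 2 first.
- have -> : (fun x => c * (peval p x * w x)) = (fun x => peval (c *: p) x * w x).
    by apply/funext => x; rewrite pevalZ; ring.
  exact: integrable_peval_weight.
- exact: integrable_peval_weight.
by rewrite RintegralZl//; [ring|exact: integrable_peval_weight].
Qed.

HB.instance Definition _ := GRing.isLinear.Build R (mpoly.mpoly d R) R *%R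
  ball_mean ball_mean_linear.

Lemma ball_meanD p q : ball_mean (p + q) = ball_mean p + ball_mean q.
Proof. exact: linearD. Qed.

Lemma ball_meanZ c p : ball_mean (c *: p) = c * ball_mean p.
Proof. exact: linearZ. Qed.

Lemma ball_mean_sum (I : Type) (r : seq I) (F : I -> mpoly.mpoly d R) :
  ball_mean (\sum_(i <- r) F i) = \sum_(i <- r) ball_mean (F i).
Proof. exact: linear_sum. Qed.

Lemma weight_mass_ge0 : 0 <= weight_mass d mu.
Proof. by apply: Rintegral_ge0 => x _; exact: weight_ge0. Qed.

Lemma ball_mean_ge0 p : (forall x, 0 <= peval p x) -> 0 <= ball_mean p.
Proof.
move=> p0; rewrite mulr_ge0 ?invr_ge0 ?weight_mass_ge0//.
by apply: Rintegral_ge0 => x _; rewrite mulr_ge0 ?weight_ge0.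
Qed.

Lemma ge0_integral_punctured_ball (h : E -> \bar R) : measurable_fun setT h ->
  (forall x, 0 <= h x)%E ->
  (\int[vol]_(x in B) h x = \int[vol]_(x in pb) h x)%E.
Proof.
move=> mh h0; rewrite (@ge0_negligible_integral _ _ _ vol B [set x | enorm x = 0])//.
- congr integral; apply/seteqP; split=> x; rewrite /unit_ball /punctured_ball/=.
    by move=> [-> /eqP x0]; rewrite andbT lt_neqAle eq_sym x0 enorm_ge0.
  by move=> /andP[x0 ->]; split=> //; apply/eqP; rewrite gt_eqF.
- rewrite (_ : [set x | _] = @enorm R d @^-1` [set 0])//.
  by apply: measurable_preimage; [exact: measurable_enorm|exact: measurable_set1].
- exact: measurable_unit_ball.
- exact: measurable_funTS.
- exact: volume_origin.
Qed.

(** The surface measure is [d] times the pushforward by [radial] of the volume on the punctured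
    ball, and it gives no mass to the complement of the sphere. *)
Lemma ge0_integral_sphere (h : E -> \bar R) : measurable_fun setT h ->
  (forall x, 0 <= h x)%E ->
  (\int[sigma]_(x in S) h x = d%:R%:E * \int[vol]_(x in pb) h (radial x))%E.
Proof.
move=> mh h0; have mS := @measurable_unit_sphere R d.
have mpb := @measurable_punctured_ball R d.
transitivity (\int[sigma]_x h x)%E.
  rewrite [RHS](@ge0_negligible_integral _ _ _ sigma setT (~` S))//.
  - by rewrite setTD setCK.
  - exact: measurableC.
  - rewrite /= /surface_measure -[_ `&` _](_ : set0 = _) ?measure0 ?mule0//.
    apply/esym/seteqP; split=> // x [/= nS /andP[x0 _]]; apply: nS.
    exact: enorm_radial.
pose k : {nonneg R} := NngNum (ler0n R d).
have -> : (\int[sigma]_x h x = \int[mscale k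
   (measure_function_pushforward__canonical__measure_function_Measure
     (mrestr vol mpb) (@measurable_radial R d))]_x h x)%E.
  exact: eq_measure_integral.
rewrite ge0_integral_mscale//; congr (_ * _)%E.
rewrite -(ge0_integral_mrestr vol mpb)//; last first.
  exact: (measurableT_comp mh (@measurable_radial R d)).
by rewrite [LHS]ge0_integral_pushforward//; exact: measurable_radial.
Qed.

Lemma integrable_radial_moment m : vol.-integrable B (EFin \o w) ->
  vol.-integrable B (EFin \o (fun x => enorm x ^+ m * w x)).
Proof.
move=> iw; apply: (@bounded_integrable_weight _ 1) => //.
  by apply: measurable_funX; exact: measurable_enorm.
by move=> x x1; rewrite ger0_norm ?exprn_ge0 ?enorm_ge0// exprn_ile1 ?enorm_ge0.
Qed.

(** Homogeneity writes the integrand as a function of |x| times [p] at the direction of [x], and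
    [polar_integral] separates the two. Nonnegativity is what its Tonelli argument asks for; the
    lemma is applied to squares. *)
Lemma ball_mean_homog m p : p \is homog m -> (forall x, 0 <= peval p x) ->
  ball_mean p = radial_moment m * sphere_mean p.
Proof.
move=> hp p0; rewrite /ball_mean /radial_moment /sphere_mean.
have [iw|/weight_mass_eq0->] := pselect (vol.-integrable B (EFin \o w)); last first.
  by rewrite invr0 !mul0r.
(* The absolute value makes [g] nonnegative at negative [r] too, as [polar_integral] demands. *)
pose g (r : R) := (`|r| ^+ m * (1 - r ^+ 2) `^ mu)%:E.
have gE x : g (enorm x) = (enorm x ^+ m * w x)%:E by rewrite /g ger0_norm ?enorm_ge0.
have g0 r : (0 <= g r)%E by rewrite lee_fin mulr_ge0// powR_ge0.
have mg : measurable_fun [set: measurableTypeR R] g.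
  apply/measurable_EFinP; apply: measurable_funM.
    by apply: measurable_funX; exact: normr_measurable.
  apply: measurable_fun_powRl.
  by apply: measurable_funB => //; exact: measurable_funX.
pose h x := (peval p x)%:E.
have mh : measurable_fun setT h by apply/measurable_EFinP; exact: measurable_peval.
have h0 x : (0 <= h x)%E by rewrite lee_fin.
have := polar_integral d0 mg g0 mh h0.
have mgn : measurable_fun setT (fun x => g (enorm x)).
  exact: (measurableT_comp mg (@measurable_enorm R d)).
rewrite -(ge0_integral_punctured_ball mgn)//.
have -> : (\int[vol]_(x in pb) (g (enorm x) * h (radial x)) =
    \int[vol]_(x in B) (peval p x * w x)%:E)%E.
  rewrite ge0_integral_punctured_ball.
  - apply: eq_integral => x /set_mem/andP[x0 x1].
    rewrite gE -EFinM -[in RHS](radialK x0) (peval_homothety _ _ hp) mulrAC.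
    by rewrite /w radialK.
  - apply/measurable_EFinP; apply: measurable_funM; first exact: measurable_peval.
    exact: measurable_weight.
  - by move=> x; rewrite lee_fin mulr_ge0 ?weight_ge0.
have -> : (\int[vol]_(x in B) g (enorm x) = \int[vol]_(x in B) (enorm x ^+ m * w x)%:E)%E.
  by apply: eq_integral => x _; rewrite gE.
have := ge0_integral_sphere mh h0.
have V0 := volume_punctured_ball_gt0 R d0.
have VE : vol pb = (fine (vol pb))%:E by rewrite fineK// volume_punctured_ball_fin.
have SE : sphere_area R d = d%:R * fine (vol pb).
  by rewrite sphere_areaE surface_measure_sphere VE.
have mB := @measurable_unit_ball R d.
have mS := @measurable_unit_sphere R d.
have I1 : (\int[vol]_(x in B) (peval p x * w x)%:E)%E =
    (\int[vol]_(x in B) (peval p x * w x))%:E.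
  rewrite /Rintegral fineK//; apply: integrable_fin_num => //.
  exact: integrable_peval_weight.
have I2 : (\int[vol]_(x in B) (enorm x ^+ m * w x)%:E)%E =
    (\int[vol]_(x in B) (enorm x ^+ m * w x))%:E.
  rewrite /Rintegral fineK//; apply: integrable_fin_num => //.
  exact: integrable_radial_moment.
have I3 : (\int[sigma]_(x in S) h x)%E = (\int[sigma]_(x in S) (peval p x))%:E.
  rewrite /Rintegral fineK//; apply: integrable_fin_num => //.
  exact: integrable_sphere.
rewrite I1 I2 I3 VE SE; move: V0; rewrite VE lte_fin.
set V := fine _; set H := (\int[vol]_(x in pb) h (radial x))%E => V0 sH.
have dn0 : d%:R != 0 :> R by rewrite pnatr_eq0 -lt0n.
(* By [sH], [d] times [H] is the finite integral of [p] over the sphere. *)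
have Hfin : H \is a fin_num.
  move: sH; rewrite /H; have : (0 <= H)%E by exact: integral_ge0.
  by rewrite /H; case: (integral _ _ _) => [r//| |//] _; rewrite gt0_muley// lte_fin ltr0n.
move: sH; rewrite -(fineK Hfin) -!EFinM => -[sH] [VH].
set X := Rintegral vol B (fun x => peval p x * w x) in VH *.
have -> : X = V^-1 * (\int[vol]_(x in B) (enorm x ^+ m * w x) * fine H).
  by rewrite -VH mulKf// gt_eqF.
rewrite sH /= -!mulrA; congr (_ * _); rewrite mulrCA; congr (_ * _).
by field; rewrite dn0 gt_eqF.
Qed.

(** Dominated convergence with the weight as dominating function: |x|^m tends to 0 off the sphere,
    which is a null set. If the weight is not integrable, all the moments are 0. *)
Lemma cvg_radial_moment : radial_moment m @[m --> \oo] --> (0 : R).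
Proof.
have [iw|mw0] := pselect (vol.-integrable B (EFin \o w)); last first.
  rewrite (_ : radial_moment = cst 0); first exact: cvg_cst.
  by apply/funext => m; rewrite /radial_moment weight_mass_eq0// invr0 mul0r.
have mB := @measurable_unit_ball R d.
have mw := measurable_weight.
have men := @measurable_enorm R d.
pose f_ m x := (enorm x ^+ m * w x)%:E.
have h1 m : measurable_fun B (f_ m).
  by apply/measurable_EFinP/measurable_funTS/measurable_funM => //; exact: measurable_funX.
have h2 : {ae vol, forall x, B x -> f_ ^~ x @ \oo --> (0%R%:E)}.
  exists S; split; [exact: measurable_unit_sphere|exact: volume_unit_sphere|].
  move=> x /= nx; apply: contrapT => Sx; apply: nx => Bx.
  apply: cvg_EFin; first by apply: nearW.
  rewrite -(mul0r (w x)); apply: cvgM; last exact: cvg_cst.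
  apply: cvg_expr; rewrite ger0_norm ?enorm_ge0// lt_neqAle Bx andbT.
  by apply/eqP.
have h3 : {ae vol, forall x m, B x -> (`|f_ m x| <= (w x)%:E)%E}.
  apply: aeW => x m Bx; rewrite lee_fin normrM [`|w x|]ger0_norm ?weight_ge0//.
  by rewrite ler_piMl ?weight_ge0// ger0_norm ?exprn_ge0 ?enorm_ge0// exprn_ile1 ?enorm_ge0.
have [_ _] := dominated_convergence mB h1 (@measurable_cst _ _ _ _ _ _) h2 iw h3.
rewrite integral_cst// mul0e => /fine_cvg h.
rewrite -(mulr0 (weight_mass d mu)^-1); apply: cvgM; first exact: cvg_cst.
exact: h.
Qed.

End ball_mean.

(** * Reproducing kernels on the sphere *)

(** Cauchy-Schwarz for a semidefinite binary form, so that it serves both the mean over the sphere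
    and the weighted sums in [polynomial_kernel_ge]. *)
Lemma discriminant_le (R : realFieldType) (a b c : R) :
  (forall s t, 0 <= s ^+ 2 * a + 2 * (s * t) * b + t ^+ 2 * c) -> b ^+ 2 <= a * c.
Proof.
move=> h.
have c0 : 0 <= c by have := h 0 1; rewrite !expr2; lra.
move: c0; rewrite le_eqVlt => /predU1P[c0|c0].
  have [->|b0] := eqVneq b 0; first by rewrite -c0 mulr0 expr0n.
  (* With [c = 0] the form is affine in [t] at [s = 1]; this [t] gives it the value -1. *)
  have := h 1 (- (a + 1) / (2 * b)).
  rewrite -c0 mulr0 addr0 expr1n !mul1r mulr0 => h1.
  have e : 2 * (- (a + 1) / (2 * b)) * b = - (a + 1) by field.
  by move: h1; rewrite e; lra.
(* The minimizing ratio [t / s = - b / c], cleared of its denominator. *)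
have := h c (- b).
have -> : c ^+ 2 * a + 2 * (c * - b) * b + (- b) ^+ 2 * c = c * (a * c - b ^+ 2) by ring.
by rewrite pmulr_rge0// subr_ge0.
Qed.

Lemma mulmx_col (R : pzRingType) m n p (A : 'M[R]_(m, n)) (B : 'M[R]_(n, p)) l :
  A *m col l B = col l (A *m B).
Proof. by rewrite !colE mulmxA. Qed.

Section reproducing_kernel.
Variables (R : realType) (n N : nat).
Local Notation d := n.+1.
Local Notation E := (euclidean R d).
Local Notation S := (@unit_sphere R d).
Local Notation mean := (@sphere_mean R d).
Variable b : 'I_N -> mpoly.mpoly d R.

Let d0 : (0 < d)%N. Proof. by []. Qed.

Lemma sphere_mean_CS (p q : mpoly.mpoly d R) :
  mean (p * q) ^+ 2 <= mean (p * p) * mean (q * q).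
Proof.
apply: discriminant_le => s t.
have e : (s *: p + t *: q) * (s *: p + t *: q) =
    s ^+ 2 *: (p * p) + ((2 * (s * t)) *: (p * q) + t ^+ 2 *: (q * q)).
  have sM (a c : R) (f g : mpoly.mpoly d R) : (a *: f) * (c *: g) = (a * c) *: (f * g).
    by rewrite -scalerAl -scalerAr scalerA.
  have -> : 2 * (s * t) = s * t + s * t by ring.
  by rewrite mulrDl !mulrDr !sM scalerDl [q * p]mulrC [t * s]mulrC !expr2 !addrA.
rewrite -addrA -!sphere_meanZ -!sphere_meanD -e.
by apply: sphere_mean_ge0 => // x _; rewrite pevalM -expr2 sqr_ge0.
Qed.

Definition values (x : E) : 'rV[R]_N := \row_i peval (b i) x.

Definition combination (c : 'cV[R]_N) : mpoly.mpoly d R := \sum_i c i 0 *: b i.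

Lemma peval_combination c x : peval (combination c) x = (values x *m c) 0 0.
Proof.
rewrite peval_sum mxE; apply: eq_bigr => i _.
by rewrite pevalZ mxE mulrC.
Qed.

Definition gram : 'M[R]_N := \matrix_(i, j) mean (b i * b j).

Lemma gram_sym : gram^T = gram.
Proof. by apply/matrixP => i j; rewrite !mxE mulrC. Qed.

Lemma mean_combination c c' :
  mean (combination c * combination c') = (c^T *m gram *m c') 0 0.
Proof.
rewrite mxE mulr_sumr sphere_mean_sum; apply: eq_bigr => j _.
rewrite mxE mulr_suml mulr_suml sphere_mean_sum; apply: eq_bigr => i _.
have -> : c i 0 *: b i * (c' j 0 *: b j) = (c i 0 * c' j 0) *: (b i * b j).
  by rewrite -scalerAl -scalerAr scalerA.
by rewrite sphere_meanZ [c^T 0 i]mxE [gram i j]mxE; ring.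
Qed.

(** Both hypotheses bear on values: [b_free] is independence as functions on the sphere, which is
    stronger than independence as polynomials, since |x|^2 - 1 vanishes there. *)
Hypothesis b_isometry : forall f : E -> E, isometry f ->
  exists M : 'M[R]_N, forall x, values (f x) = values x *m M.
Hypothesis b_free : forall c : 'cV[R]_N,
  (forall x, S x -> values x *m c = 0) -> c = 0.

Lemma gram_isometry (f : E -> E) (M : 'M[R]_N) : isometry f ->
  (forall x, values (f x) = values x *m M) -> M^T *m gram *m M = gram.
Proof.
move=> jf fM; apply/matrixP => j k.
have e l x : peval (combination (col l M)) x = peval (b l) (f x).
  by rewrite peval_combination mulmx_col -fM !mxE.
transitivity (mean (combination (col j M) * combination (col k M))).
  by rewrite mean_combination tr_col -row_mul mulmx_col -row_mul !mxE.
by rewrite mxE; apply: sphere_mean_isometry jf _ => // x; rewrite !pevalM !e.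
Qed.

(** Isotropic vectors of a semidefinite form lie in its radical, by Cauchy-Schwarz against each
    basis vector. *)
Lemma gram_null (u : 'rV[R]_N) : (u *m gram *m u^T) 0 0 = 0 -> u *m gram = 0.
Proof.
move=> u0; apply/rowP => j.
have := sphere_mean_CS (combination u^T) (combination (delta_mx j 0 : 'cV[R]_N)).
rewrite !mean_combination trmxK u0 mul0r => h; apply/eqP.
have : ((u *m gram *m (delta_mx j 0 : 'cV[R]_N)) 0 0) ^+ 2 == 0.
  by rewrite eq_le h sqr_ge0.
by rewrite sqrf_eq0 -colE !mxE.
Qed.

(* The combinations of mean square 0 are spanned by finitely many of them, which
   vanish almost everywhere and so have a common zero on the sphere. The set of
   the common zeros is invariant under isometries, hence is the whole sphere. *)
Lemma gram_unit : gram \in unitmx.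
Proof.
rewrite -row_free_unit -kermx_eq0; set K := kermx gram.
have KG : K *m gram = 0 by exact: mulmx_ker.
have [y0 Sy0 y0K] : exists2 y, S y & values y *m K^T = 0.
  (* A sum of squares over generators of the kernel: a zero of [h] is a common zero of all of
     them. *)
  pose h := \sum_i combination (row i K)^T * combination (row i K)^T.
  have h0 : mean h = 0.
    rewrite sphere_mean_sum big1// => i _.
    by rewrite mean_combination trmxK -row_mul KG row0 mul0mx mxE.
  have hE x : peval h x = \sum_i (values x *m K^T) 0 i ^+ 2.
    rewrite peval_sum; apply: eq_bigr => i _.
    by rewrite pevalM peval_combination tr_row mulmx_col -expr2 [col i _ 0 0]mxE.
  have [|y Sy] := sphere_mean_eq0 d0 _ h0.
    by move=> x _; rewrite hE sumr_ge0// => i _; exact: sqr_ge0.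
  rewrite hE => /eqP; rewrite psumr_eq0; last by move=> i _; exact: sqr_ge0.
  move=> /allP hy; exists y => //; apply/rowP => i; rewrite [RHS]mxE.
  by have := hy i (mem_index_enum i); rewrite sqrf_eq0 => /eqP.
apply/eqP/row_matrixP => i; rewrite row0; set u := row i K.
suff : u^T = 0 by move/(congr1 trmx); rewrite trmxK trmx0.
apply: b_free => x Sx.
have [f jf <-] := isometry_transitive Sy0 Sx.
have [M fM] := b_isometry jf; have MG := gram_isometry jf fM.
have uG : u *m gram = 0 by rewrite -row_mul KG row0.
(* Composition with [f] sends the coefficients [u] to [u *m M^T], again in the kernel. The new
   combination vanishes at [y0], which says that the old one vanishes at [f y0]. *)
have : u *m M^T *m gram = 0.
  apply: gram_null.
  have -> : u *m M^T *m gram *m (u *m M^T)^T = u *m (M^T *m gram *m M) *m u^T.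
    by rewrite trmx_mul trmxK !mulmxA.
  by rewrite MG uG mul0mx mxE.
move/sub_kermxP => /submxP[D uD].
by rewrite fM -mulmxA -[M]trmxK -trmx_mul uD trmx_mul mulmxA y0K mul0mx.
Qed.

Let kernel x := (values x *m invmx gram *m (values x)^T) 0 0.

(** From [M^T *m gram *m M = gram] and the invertibility of [gram], [M] is invertible and the
    inverse Gram matrix satisfies the transposed relation [e]. *)
Let kernel_isometry f x : isometry f -> kernel (f x) = kernel x.
Proof.
move=> jf; have [M fM] := b_isometry jf; have MG := gram_isometry jf fM.
have Gu := gram_unit.
have Mu : M \in unitmx.
  by have := Gu; rewrite -MG unitmx_mul => /andP[].
have e : M *m invmx gram *m M^T = invmx gram.
  have h : M *m invmx gram *m M^T *m gram = 1%:M.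
    apply: (can_inj (mulmxK Mu)); rewrite mul1mx.
    have -> : M *m invmx gram *m M^T *m gram *m M = M *m invmx gram *m (M^T *m gram *m M).
      by rewrite !mulmxA.
    by rewrite MG mulmxKV.
  by rewrite -[LHS](mulmxK Gu) h mul1mx.
by rewrite /kernel -[in RHS]e fM trmx_mul !mulmxA.
Qed.

(* The kernel is constant on the sphere, and its mean is the trace of
   invmx gram *m gram. *)
Lemma kernel_sphere x : S x -> (values x *m invmx gram *m (values x)^T) 0 0 = N%:R.
Proof.
move=> Sx; rewrite -/(kernel x).
pose k := \sum_i \sum_j invmx gram i j *: (b i * b j).
have kE y : peval k y = kernel y.
  rewrite /kernel -mulmxA mxE peval_sum; apply: eq_bigr => i _.
  rewrite peval_sum !mxE mulr_sumr; apply: eq_bigr => j _.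
  by rewrite pevalZ pevalM !mxE; ring.
have : mean k = mean (kernel x *: 1).
  apply: eq_sphere_mean => y Sy; rewrite kE pevalZ peval1 mulr1.
  by have [f jf <-] := isometry_transitive Sx Sy; rewrite kernel_isometry.
rewrite sphere_meanZ sphere_mean1// mulr1 => <-.
rewrite sphere_mean_sum -(mxtrace1 R N) -(mulVmx gram_unit) /mxtrace.
apply: eq_bigr => i _; rewrite sphere_mean_sum mxE; apply: eq_bigr => j _.
by rewrite sphere_meanZ; congr (_ * _); rewrite mxE mulrC.
Qed.

(** The reproducing property: [invmx gram *m (values x)^T] holds the coefficients of the kernel at
    [x], and the mean of a combination against it is the value at [x]. *)
Let dual x : (invmx gram *m (values x)^T)^T *m gram = values x.
Proof.
by rewrite trmx_mul trmxK trmx_inv gram_sym (mulmxKV gram_unit).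
Qed.

Lemma peval_sqr_le c x : S x ->
  peval (combination c) x ^+ 2 <= N%:R * mean (combination c * combination c).
Proof.
move=> Sx.
have := sphere_mean_CS (combination (invmx gram *m (values x)^T)) (combination c).
by rewrite !mean_combination peval_combination dual mulmxA kernel_sphere.
Qed.

Lemma peval_sqr_attained x : S x -> exists c,
  peval (combination c) x = N%:R /\ mean (combination c * combination c) = N%:R.
Proof.
move=> Sx; exists (invmx gram *m (values x)^T).
by rewrite mean_combination peval_combination dual mulmxA kernel_sphere.
Qed.

End reproducing_kernel.

(** * Homogeneous polynomials on the sphere *)

(** Uniqueness of base [k] digits, read off modulo [k] from the lowest one; it keeps distinct
    monomials distinct under Kronecker substitution. *)
Lemma digits_inj k n (f g : 'I_n -> nat) :
  (forall i, f i < k)%N -> (forall i, g i < k)%N ->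
  (\sum_i f i * k ^ i = \sum_i g i * k ^ i)%N -> f =1 g.
Proof.
elim: n f g => [|n IH] f g fk gk; first by move=> _ [].
have digits0 (h : 'I_n.+1 -> nat) : (\sum_i h i * k ^ i =
    (\sum_(i < n) h (lift ord0 i) * k ^ i) * k + h ord0)%N.
  rewrite big_ord_recl muln1 addnC big_distrl; congr (_ + _)%N.
  by apply: eq_bigr => i _; rewrite /= /bump/= add1n expnSr mulnA.
rewrite !digits0 => e.
have k0 : (0 < k)%N := leq_ltn_trans (leq0n _) (fk ord0).
have e0 : f ord0 = g ord0.
  by have := congr1 (modn^~ k) e; rewrite !modnMDl !modn_small.
move: e; rewrite e0 => /addIn /eqP; rewrite eqn_pmul2r// => /eqP /IH h i.
case: (unliftP ord0 i) => [j|] -> //.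
exact: h.
Qed.

Section vanishing.
Variables (R : realType) (n : nat).

(* Kronecker substitution: the variables are replaced by the powers t ^ (k ^ i)
   of one variable t, where k exceeds all exponents. *)
Lemma mpoly_vanishing (p : mpoly.mpoly n R) :
  (forall v, mpoly.meval v p = 0) -> p = 0.
Proof.
move=> p0; apply/mpoly.mpolyP => m0; rewrite mpoly.mcoeff0.
have [m0p|] := boolP (m0 \in mpoly.msupp p); last by move=> /mpoly.memN_msupp_eq0.
set s := mpoly.msupp p in m0p *; pose k := mpoly.mmeasure mpoly.mdeg p.
pose e (m : mpoly.multinom n) := (\sum_(i < n) m i * k ^ i)%N.
have small m : m \in s -> forall i, (m i < k)%N.
  move=> ms i; apply: leq_ltn_trans (mpoly.msize_mdeg_lt ms).
  by rewrite mpoly.mdegE (bigD1 i)//= leq_addr.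
have e_inj m m' : m \in s -> m' \in s -> e m = e m' -> m = m'.
  by move=> ms ms' /digits_inj h; apply/mpoly.mnmP => i; apply: h; exact: small.
pose q : {poly R} := \sum_(m <- s) mpoly.mcoeff m p *: 'X^(e m).
have q0 : q = 0.
  (* As many distinct roots as [size q], one more than a nonzero [q] can have. *)
  pose rs := [seq i%:R : R | i <- iota 0 (size q)].
  apply: (@roots_geq_poly_eq0 _ _ rs).
  - apply/allP => t _; rewrite /root horner_sum; apply/eqP.
    rewrite -[RHS](p0 (fun i => t ^+ (k ^ i))) mpoly.mevalE.
    apply: eq_bigr => m _; rewrite hornerZ hornerXn; congr (_ * _).
    rewrite -prodrXr; apply: eq_bigr => i _.
    by rewrite -exprM mulnC.
  - by rewrite map_inj_uniq ?iota_uniq// => i j /eqP; rewrite eqr_nat => /eqP.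
  - by rewrite size_map size_iota.
have := congr1 (fun q : {poly R} => q`_(e m0)) q0; rewrite coef0 coef_sum.
rewrite (bigD1_seq m0) ?mpoly.msupp_uniq//= coefZ coefXn eqxx mulr1.
rewrite big_seq_cond big1 ?addr0// => m /andP[ms mm0].
rewrite coefZ coefXn; case: eqP; rewrite ?mulr0// => /e_inj em.
by rewrite em ?eqxx// in mm0.
Qed.

End vanishing.

Section homogeneous_pairs.
Variables (R : realType) (n k : nat).
Local Notation d := n.+1.
Local Notation E := (euclidean R d).
Local Notation S := (@unit_sphere R d).
Local Notation mpo := (mpoly.mpoly d R).
Implicit Types (p q : mpo) (x : E).

Lemma polar_decomposition x : exists r y, S y /\ x = homothety r y.
Proof.
have [x0|x0] := eqVneq (enorm x) 0.
  exists 0, (pole R n); split.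
    apply/eqP; rewrite -(@eqrXn2 _ 2)// ?enorm_ge0// sqr_enorm dotp_cons dotp0.
    by rewrite mulr1 addr0 expr1n.
  apply/eq_from_tnth => i; rewrite tnth_mktuple mul0r.
  by apply: dotp_eq0; rewrite -sqr_enorm x0 expr0n.
have x0' : 0 < enorm x by rewrite lt_neqAle eq_sym x0 enorm_ge0.
by exists (enorm x), (radial x); split; [exact: enorm_radial|rewrite radialK].
Qed.

Lemma homog_vanishing m p : p \is homog m -> (forall x, S x -> peval p x = 0) -> p = 0.
Proof.
move=> hp p0; apply: mpoly_vanishing => v.
have [r [y [Sy vE]]] := polar_decomposition [tuple v i | i < d].
have -> : mpoly.meval v p = peval p [tuple v i | i < d].
  by apply: mpoly.meval_eq => i; rewrite tnth_mktuple.
by rewrite vE (peval_homothety _ _ hp) p0// mulr0.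
Qed.

Lemma sphere_opp x : S x -> S (homothety (-1) x).
Proof. by move=> Sx; rewrite /unit_sphere/= enorm_homothety normrN1 mul1r. Qed.

(** Consecutive degrees have opposite parities, so the values at [x] and at its antipode give
    [p1 + p2] and, up to sign, [p1 - p2]. *)
Lemma homog_pair_vanishing p1 p2 : p1 \is homog k.+1 -> p2 \is homog k ->
  (forall x, S x -> peval (p1 + p2) x = 0) -> p1 = 0 /\ p2 = 0.
Proof.
move=> h1 h2 p0.
have both x : S x -> peval p1 x = 0 /\ peval p2 x = 0.
  move=> Sx; have := p0 _ Sx; have := p0 _ (sphere_opp Sx).
  rewrite !pevalD (peval_homothety _ _ h1) (peval_homothety _ _ h2) exprS -mulrA.
  rewrite mulN1r -mulrN -mulrDr => /eqP; rewrite mulf_eq0 signr_eq0/= => /eqP e1 e2.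
  by split; lra.
split; [apply: homog_vanishing h1 _|apply: homog_vanishing h2 _] => x /both[] //.
Qed.

Lemma sphere_mean_odd m p : p \is homog m -> odd m -> sphere_mean p = 0.
Proof.
move=> hp om.
have : sphere_mean (- p) = sphere_mean p.
  apply: (sphere_mean_isometry (isometry_opp R d)) => x.
  rewrite (peval_homothety _ _ hp) -signr_odd om mulN1r.
  exact: mpoly.mevalN.
rewrite -scaleN1r sphere_meanZ; lra.
Qed.

(** The mixed product has odd degree 2k + 1, so the antipodal map makes its mean vanish. *)
Lemma sphere_mean_pair p1 p2 : p1 \is homog k.+1 -> p2 \is homog k ->
  sphere_mean ((p1 + p2) * (p1 + p2)) = sphere_mean (p1 * p1) + sphere_mean (p2 * p2).
Proof.
move=> h1 h2.
have h12 : sphere_mean (p1 * p2) = 0.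
  apply: (sphere_mean_odd (mpoly.dhomogM h1 h2)).
  by rewrite oddD oddS addNb addbb.
by rewrite mulrDl !mulrDr !sphere_meanD [p2 * p1]mulrC h12 addr0 add0r.
Qed.

Lemma radial_moment_ge0 (mu : R) m : 0 <= radial_moment d mu m.
Proof.
rewrite mulr_ge0 ?invr_ge0 ?weight_mass_ge0//; apply: Rintegral_ge0 => x _.
by rewrite mulr_ge0 ?weight_ge0// exprn_ge0// enorm_ge0.
Qed.

(** [ball_mean_homog] covers the two squares but not the mixed product. The latter is absorbed by
    (p1 - p2)^2 >= 0, which costs the factor 2; by [sphere_mean_pair], each square has mean at most
    that of the whole. *)
Lemma ball_mean_pair mu p1 p2 : p1 \is homog k.+1 -> p2 \is homog k ->
  ball_mean mu ((p1 + p2) * (p1 + p2)) <=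
  2 * (radial_moment d mu (k.+1 + k.+1) + radial_moment d mu (k + k)) *
    sphere_mean ((p1 + p2) * (p1 + p2)).
Proof.
move=> h1 h2; rewrite sphere_mean_pair//.
have sq p x : 0 <= peval (p * p) x by rewrite pevalM -expr2 sqr_ge0.
have m0 p : 0 <= sphere_mean (p * p) by apply: sphere_mean_ge0.
have := ball_mean_homog mu (ltn0Sn n) (mpoly.dhomogM h1 h1) (sq p1).
have := ball_mean_homog mu (ltn0Sn n) (mpoly.dhomogM h2 h2) (sq p2).
have := ball_mean_ge0 mu (sq (p1 - p2)).
have -> : (p1 - p2) * (p1 - p2) = 2 *: (p1 * p1) + 2 *: (p2 * p2) +
    (-1) *: ((p1 + p2) * (p1 + p2)).
  by rewrite scaleN1r !scaler_nat; ring.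
rewrite !ball_meanD !ball_meanZ => h e2 e1; rewrite e1 e2 in h.
have r1 := radial_moment_ge0 mu (k.+1 + k.+1); have r2 := radial_moment_ge0 mu (k + k).
have := mulr_ge0 r1 (m0 p2); have := mulr_ge0 r2 (m0 p1).
by move: h; set a := ball_mean _ _; lra.
Qed.

End homogeneous_pairs.

Section homogeneous_basis.
Variables (R : realType) (n k : nat).
Local Notation d := n.+1.
Local Notation E := (euclidean R d).
Local Notation S := (@unit_sphere R d).
Local Notation mpo := (mpoly.mpoly d R).
Implicit Types (p q : mpo) (x : E).

Definition monomials m : seq (mpoly.multinom d) :=
  [seq mpoly.s2m (tval t) | t <- enum (mpoly.basis d m)].

Lemma mem_monomials m a : (a \in monomials m) = (mpoly.mdeg a == m).
Proof. by rewrite mpoly.basis_cover. Qed.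

Definition exponents := monomials k.+1 ++ monomials k.

Lemma mem_exponents a : (a \in exponents) = (mpoly.mdeg a == k.+1) || (mpoly.mdeg a == k).
Proof. by rewrite mem_cat !mem_monomials. Qed.

Lemma exponents_uniq : uniq exponents.
Proof.
rewrite cat_uniq !mpoly.uniq_basis andbT/=; apply/hasPn => a.
by rewrite !mem_monomials => /eqP ->; rewrite (ltn_eqF (ltnSn k)).
Qed.

(** The [N] of the overview for degree [k + 1] in [n + 1] variables; a successor degree avoids
    truncated subtraction in the lower one. *)
Definition pair_dim := ('C(k.+1 + n, k.+1) + 'C(k + n, k))%N.

Lemma size_exponents : size exponents = pair_dim.
Proof. by rewrite size_cat !mpoly.size_basis. Qed.

Definition exponent (i : 'I_pair_dim) : mpoly.multinom d :=
  tnth (Tuple (introT eqP size_exponents)) i.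

Lemma exponent_inj : injective exponent.
Proof. by apply/tuple_uniqP; exact: exponents_uniq. Qed.

Lemma exponentP a : reflect (exists i, a = exponent i) (a \in exponents).
Proof. exact: (@tnthP _ _ (Tuple (introT eqP size_exponents))). Qed.

Definition monomial (i : 'I_pair_dim) : mpo := mpoly.mpolyX R (exponent i).

Lemma mcoeff_combination c i :
  mpoly.mcoeff (exponent i) (combination monomial c) = c i 0.
Proof.
rewrite raddf_sum (bigD1 i)//= mpoly.mcoeffZ mpoly.mcoeffX eqxx mulr1.
rewrite big1 ?addr0// => j ji; rewrite mpoly.mcoeffZ mpoly.mcoeffX.
by rewrite (inj_eq exponent_inj) (negPf ji) mulr0.
Qed.

Lemma mcoeff_combination_out c a : a \notin exponents ->
  mpoly.mcoeff a (combination monomial c) = 0.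
Proof.
move=> ae; rewrite raddf_sum big1// => j _ /=; rewrite mpoly.mcoeffZ mpoly.mcoeffX.
case: eqP => [ja|]; last by rewrite mulr0.
by move/exponentP: ae; case; exists j.
Qed.

Lemma combination_homog_pair p1 p2 : p1 \is homog k.+1 -> p2 \is homog k ->
  exists c, p1 + p2 = combination monomial c.
Proof.
move=> h1 h2; exists (\col_i mpoly.mcoeff (exponent i) (p1 + p2)).
apply/mpoly.mpolyP => a; have [/exponentP[i ->]|ae] := boolP (a \in exponents).
  by rewrite mcoeff_combination mxE.
rewrite mcoeff_combination_out// mpoly.mcoeffD.
move: ae; rewrite mem_exponents negb_or => /andP[a1 a2].
by rewrite (mpoly.dhomog_nemf_coeff h1 a1) (mpoly.dhomog_nemf_coeff h2 a2) addr0.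
Qed.

Lemma homog_pair_combination c : exists p1 p2,
  [/\ p1 \is homog k.+1, p2 \is homog k & combination monomial c = p1 + p2].
Proof.
exists (\sum_(i | mpoly.mdeg (exponent i) == k.+1) c i 0 *: monomial i),
  (\sum_(i | mpoly.mdeg (exponent i) != k.+1) c i 0 *: monomial i); split.
- apply: rpred_sum => i ei; apply: mpoly.dhomogZ.
  by rewrite mpoly.dhomogX.
- apply: rpred_sum => i ei; apply: mpoly.dhomogZ.
  rewrite mpoly.dhomogX; have : exponent i \in exponents by apply/exponentP; exists i.
  by rewrite mem_exponents (negPf ei).
- exact: bigID.
Qed.

Lemma monomial_free (c : 'cV[R]_pair_dim) :
  (forall x, S x -> values monomial x *m c = 0) -> c = 0.
Proof.
move=> c0; have [p1 [p2 [h1 h2 cE]]] := homog_pair_combination c.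
have [|e1 e2] := homog_pair_vanishing h1 h2.
  by move=> x Sx; rewrite -cE peval_combination c0// mxE.
apply/colP => i; rewrite -mcoeff_combination cE e1 e2 addr0 mpoly.mcoeff0.
by rewrite mxE.
Qed.

(** Substituting linear forms for the variables turns a monomial into a product of as many linear
    forms as its degree. *)
Lemma homog_comp_linmap (f : E -> E) a : linmap f -> exists2 p : mpo,
  p \is homog (mpoly.mdeg a) & forall x, peval p x = peval (mpoly.mpolyX R a) (f x).
Proof.
move=> /choice[w wE].
pose l := [tuple \sum_j tnth (w i) j *: mpoly.mpolyX R (mpoly.mnm1 j) | i < d].
exists (mpoly.comp_mpoly l (mpoly.mpolyX R a)).
  rewrite mpoly.comp_mpolyX mpoly.mdegE.
  elim/big_rec2 : _ => [|i m p _ hp]; first exact: mpoly.dhomog1.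
  apply: mpoly.dhomogM => //.
  suff /(mpoly.dhomogMn (a i)) : tnth l i \is homog 1 by rewrite mul1n.
  rewrite tnth_mktuple; apply: rpred_sum => j _; apply: mpoly.dhomogZ.
  by rewrite mpoly.dhomogX; apply/eqP; exact: mpoly.mdeg1.
move=> x; rewrite /peval mpoly.comp_mpoly_meval; apply: mpoly.meval_eq => i.
rewrite tnth_mktuple -/(peval _ x) peval_sum.
have -> := congr1 (@^~ x) (wE i); apply: eq_bigr => j _.
by rewrite pevalZ; congr (_ * _); exact: mpoly.mevalXU.
Qed.

Lemma monomial_isometry (f : E -> E) : isometry f ->
  exists M : 'M[R]_pair_dim, forall x, values monomial (f x) = values monomial x *m M.
Proof.
move=> [_ lf _].
have /choice[c cE] i : exists c : 'cV[R]_pair_dim, forall x,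
    peval (monomial i) (f x) = (values monomial x *m c) 0 0.
  have [p hp pE] := homog_comp_linmap (exponent i) lf.
  have : exponent i \in exponents by apply/exponentP; exists i.
  rewrite mem_exponents => /orP[] /eqP ek; rewrite ek in hp.
    have [c cE] := combination_homog_pair hp (rpred0 _).
    by exists c => x; rewrite -pE -peval_combination -cE addr0.
  have [c cE] := combination_homog_pair (rpred0 _) hp.
  by exists c => x; rewrite -pE -peval_combination -cE add0r.
exists (\matrix_(i, j) c j i 0) => x; apply/rowP => j.
rewrite mxE cE !mxE; apply: eq_bigr => i _.
by rewrite !mxE.
Qed.

(* Multiply every monomial by the power of |x| ^ 2 that raises its degree to k or
   to k + 1. *)
Lemma sphere_reduction p : degree_le k.+1 p -> exists p1 p2,
  [/\ p1 \is homog k.+1, p2 \is homog k &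
      forall x, S x -> peval p x = peval (p1 + p2) x].
Proof.
rewrite /degree_le => dp; pose s := mpoly.msupp p.
pose rho : mpo := \sum_(i < d) mpoly.mpolyX R (mpoly.mnm1 i) ^+ 2.
have hrho : rho \is homog 2.
  apply: rpred_sum => i _; rewrite -[2%N]mul1n; apply: mpoly.dhomogMn.
  by rewrite mpoly.dhomogX; apply/eqP; exact: mpoly.mdeg1.
have rho1 x : S x -> peval rho x = 1.
  move=> Sx; rewrite -(expr1n _ 2) -[in RHS]Sx sqr_enorm peval_sum.
  apply: eq_bigr => i _; rewrite expr2 pevalM.
  by congr (_ * _); exact: mpoly.mevalXU.
pose r (a : mpoly.multinom d) := (k.+1 - mpoly.mdeg a)%N.
(* For odd [r a] the halving rounds down, and the degree stops at [k]. *)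
pose F a := mpoly.mcoeff a p *: (mpoly.mpolyX R a * rho ^+ (r a)./2).
have hF a : a \in s -> F a \is homog (if odd (r a) then k else k.+1).
  move=> /mpoly.msize_mdeg_lt as_; have ak : (mpoly.mdeg a <= k.+1)%N.
    by rewrite -ltnS; exact: leq_trans as_ dp.
  apply: mpoly.dhomogZ.
  have -> : (if odd (r a) then k else k.+1) = (mpoly.mdeg a + 2 * (r a)./2)%N.
    have := odd_double_half (r a); rewrite -mul2n /r; case: (odd _) => /=; lia.
  apply: mpoly.dhomogM; first by rewrite mpoly.dhomogX.
  exact: mpoly.dhomogMn.
exists (\sum_(a <- s | ~~ odd (r a)) F a), (\sum_(a <- s | odd (r a)) F a); split.
- rewrite big_seq_cond; apply: rpred_sum => a /andP[as_ /negPf oa].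
  by have := hF a as_; rewrite oa.
- rewrite big_seq_cond; apply: rpred_sum => a /andP[as_ oa].
  by have := hF a as_; rewrite oa.
- move=> x Sx; rewrite addrC.
  have <- : \sum_(a <- s) F a =
      \sum_(a <- s | odd (r a)) F a + \sum_(a <- s | ~~ odd (r a)) F a.
    by rewrite (bigID (fun a => odd (r a))).
  rewrite [in LHS](mpoly.mpolyE p) !peval_sum.
  apply: eq_bigr => a _; rewrite !pevalZ pevalM.
  by rewrite pevalX rho1// expr1n mulr1.
Qed.

End homogeneous_basis.

(** * Bounds for the kernel *)

Section kernel_bounds.
Variables (R : realType) (n k : nat) (mu lambda : R).
Local Notation d := n.+1.
Local Notation E := (euclidean R d).
Local Notation S := (@unit_sphere R d).
Local Notation mpo := (mpoly.mpoly d R).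
Local Notation inner := (@ball_inner R d mu lambda).
Local Notation mean := (@sphere_mean R d).
Local Notation N := (pair_dim n k).
Implicit Types (p q f g : mpo) (x : E).
Hypothesis lambda0 : 0 < lambda.

Lemma ball_innerE f g : inner f g = ball_mean mu (f * g) + lambda * mean (f * g).
Proof.
rewrite /ball_inner /ball_mean /sphere_mean mulrA; congr (_ * _ + _ * _);
  by apply: eq_Rintegral => x _; rewrite pevalM.
Qed.

Lemma ball_innerC f g : inner f g = inner g f.
Proof. by rewrite !ball_innerE mulrC. Qed.

Lemma ball_inner_suml m (c : 'I_m -> R) (q : 'I_m -> mpo) g :
  inner (\sum_i c i *: q i) g = \sum_i c i * inner (q i) g.
Proof.
rewrite ball_innerE mulr_suml ball_mean_sum sphere_mean_sum mulr_sumr -big_split/=.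
apply: eq_bigr => i _; rewrite -scalerAl ball_meanZ sphere_meanZ ball_innerE.
by ring.
Qed.

Lemma ball_inner_sqr m (c : 'I_m -> R) (q : 'I_m -> mpo) :
  (forall i j, i != j -> inner (q i) (q j) = 0) ->
  inner (\sum_i c i *: q i) (\sum_i c i *: q i) = \sum_i c i ^+ 2 * inner (q i) (q i).
Proof.
move=> oq; rewrite ball_inner_suml; apply: eq_bigr => i _.
rewrite ball_innerC ball_inner_suml (bigD1 i)//= big1 ?addr0; first by ring.
by move=> j ji; rewrite oq// mulr0.
Qed.

Lemma sphere_mean_sqr_ge0 f : 0 <= mean (f * f).
Proof. by apply: sphere_mean_ge0 => // x _; rewrite pevalM -expr2 sqr_ge0. Qed.

Lemma ball_mean_sqr_ge0 f : 0 <= ball_mean mu (f * f).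
Proof. by apply: ball_mean_ge0 => x; rewrite pevalM -expr2 sqr_ge0. Qed.

Lemma ball_inner_ge0 f : 0 <= inner f f.
Proof.
rewrite ball_innerE addr_ge0 ?ball_mean_sqr_ge0// mulr_ge0 ?sphere_mean_sqr_ge0//.
exact: ltW.
Qed.

Lemma pair_dim_gt0 : 0 < N%:R :> R.
Proof. by rewrite ltr0n addn_gt0 bin_gt0 leq_addr. Qed.

Lemma degree_le_sum m (c : 'I_m -> R) (q : 'I_m -> mpo) :
  (forall i, degree_le k.+1 (q i)) -> degree_le k.+1 (\sum_i c i *: q i).
Proof.
move=> hq; rewrite /degree_le (leq_trans (mpoly.mmeasure_sum _ _ _ _))//.
apply/bigmax_leqP_seq => i _ _.
exact: leq_trans (mpoly.mmeasureZ_le _ _ _) (hq i).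
Qed.

Lemma peval_sqr_le_inner f x : degree_le k.+1 f -> S x ->
  peval f x ^+ 2 <= N%:R / lambda * inner f f.
Proof.
move=> df Sx; have [p1 [p2 [h1 h2 fE]]] := sphere_reduction df.
have [c cE] := combination_homog_pair h1 h2.
rewrite fE// cE.
apply: le_trans (peval_sqr_le (@monomial_isometry R n k) (@monomial_free R n k) c Sx) _.
have -> : mean (combination (@monomial R n k) c * combination (@monomial R n k) c) = mean (f * f).
  by apply: eq_sphere_mean => y Sy; rewrite !pevalM -cE fE.
rewrite -mulrA ler_wpM2l// ler_pdivlMl// ball_innerE lerDr.
exact: ball_mean_sqr_ge0.
Qed.

Lemma polynomial_kernelE (Q : seq mpo) x : polynomial_kernel mu lambda Q x x =
  \sum_(i < size Q) peval Q`_i x ^+ 2 / inner Q`_i Q`_i.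
Proof. by rewrite /polynomial_kernel (big_nth 0) big_mkord. Qed.

(** For [f] the kernel at [x], both [f x] and <f, f> equal [K], so the bound on point evaluations
    reads K^2 <= (N / lambda) K. *)
Lemma polynomial_kernel_le (Q : seq mpo) x : orthogonal_basis mu lambda k.+1 Q -> S x ->
  polynomial_kernel mu lambda Q x x <= N%:R / lambda.
Proof.
move=> [[dQ _ _] oQ] Sx; rewrite polynomial_kernelE; set K := \sum_(i < _) _.
pose c (i : 'I_(size Q)) := peval Q`_i x / inner Q`_i Q`_i.
pose f := \sum_i c i *: Q`_i.
have fK : peval f x = K.
  by rewrite peval_sum; apply: eq_bigr => i _; rewrite pevalZ /c expr2; ring.
have ffK : inner f f = K.
  rewrite ball_inner_sqr//; apply: eq_bigr => i _; rewrite /c.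
  (* Since the inverse of 0 is 0, an element of norm 0 adds nothing to either side. *)
  have [->|h0] := eqVneq (inner Q`_i Q`_i) 0; first by rewrite invr0 !mulr0.
  by field.
have K0 : 0 <= K by rewrite -ffK ball_inner_ge0.
have := peval_sqr_le_inner (degree_le_sum c dQ) Sx; rewrite -/f fK ffK expr2.
move: K0; rewrite le_eqVlt => /predU1P[<- _|K0]; last by rewrite ler_pM2r.
by rewrite divr_ge0// ltW.
Qed.

Lemma ball_inner_pair c f : f = combination (@monomial R n k) c ->
  inner f f <= (lambda + 2 * (radial_moment d mu (k.+1 + k.+1) + radial_moment d mu (k + k))) *
    mean (f * f).
Proof.
move=> f_; have [p1 [p2 [h1 h2 fE]]] := homog_pair_combination c.
rewrite ball_innerE addrC mulrDl lerD2l f_ fE.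
exact: ball_mean_pair.
Qed.

(** The extremal [f] has value and mean square both equal to N. Expanding it in [Q], Cauchy-Schwarz
    gives N^2 <= <f, f> K <= L N K. *)
Lemma polynomial_kernel_ge (Q : seq mpo) x : orthogonal_basis mu lambda k.+1 Q -> S x ->
  N%:R / (lambda + 2 * (radial_moment d mu (k.+1 + k.+1) + radial_moment d mu (k + k)))
  <= polynomial_kernel mu lambda Q x x.
Proof.
move=> [[dQ _ sQ] oQ] Sx; rewrite polynomial_kernelE; set K := \sum_(i < _) _.
set L := lambda + _.
have L0 : 0 < L by rewrite ltr_pwDl// mulr_ge0// addr_ge0// radial_moment_ge0.
have N0 := pair_dim_gt0.
have [c [fx ff]] := peval_sqr_attained (@monomial_isometry R n k) (@monomial_free R n k) Sx.
have := ball_inner_pair (erefl (combination (@monomial R n k) c)); rewrite -/L ff => fL.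
set f := combination _ c in fx ff fL.
have df : degree_le k.+1 f.
  apply: degree_le_sum => i; rewrite /degree_le mpoly.mmeasureX.
  have : exponent i \in exponents n k by apply/exponentP; exists i.
  by rewrite mem_exponents => /orP[] /eqP/= ->.
have [a fE] := sQ f df.
have CS : (\sum_i a i * peval Q`_i x) ^+ 2 <= (\sum_i a i ^+ 2 * inner Q`_i Q`_i) * K.
  apply: discriminant_le => s t; rewrite !mulr_sumr -!big_split/=.
  apply: sumr_ge0 => i _; have := ball_inner_ge0 Q`_i.
  (* If the norm of an element is 0, the bound on point evaluations makes it vanish at [x], and its
     summand is 0. *)
  rewrite le_eqVlt => /predU1P[h0|h0].
    have := peval_sqr_le_inner (dQ i) Sx; rewrite -h0 mulr0 => v0.
    have /eqP : peval Q`_i x ^+ 2 == 0 by rewrite eq_le v0 sqr_ge0.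
    by move/eqP; rewrite sqrf_eq0 => /eqP ->; rewrite expr0n/= !(mulr0, mul0r, addr0).
  have -> : s ^+ 2 * (a i ^+ 2 * inner Q`_i Q`_i) + 2 * (s * t) * (a i * peval Q`_i x) +
      t ^+ 2 * (peval Q`_i x ^+ 2 / inner Q`_i Q`_i) =
      inner Q`_i Q`_i * (s * a i + t * peval Q`_i x / inner Q`_i Q`_i) ^+ 2.
    by field; rewrite gt_eqF.
  by rewrite mulr_ge0 ?sqr_ge0// ltW.
have K0 : 0 <= K.
  by apply: sumr_ge0 => i _; rewrite divr_ge0 ?sqr_ge0// ball_inner_ge0.
have fxE : \sum_i a i * peval Q`_i x = N%:R.
  by rewrite -fx fE peval_sum; apply: eq_bigr => i _; rewrite pevalZ.
rewrite -ball_inner_sqr// -fE fxE in CS.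
have := le_trans CS (ler_wpM2r K0 fL).
rewrite expr2 mulrAC ler_pM2r// => NLK.
by rewrite ler_pdivrMr// mulrC.
Qed.

End kernel_bounds.

(** The second binomial is (k + 1) / (k + 1 + n) times the first. As [harmonic m] is 1 / (m + 1),
    the index is [k + n]. *)
Lemma pair_dim_ratio (R : realType) n k :
  (pair_dim n k)%:R / ('C(k.+1 + n, k.+1))%:R = 2 - n%:R * harmonic (k + n)%N :> R.
Proof.
rewrite /harmonic /pair_dim natrD; set B := ('C(k.+1 + n, k.+1))%:R.
have b0 : B != 0 by rewrite pnatr_eq0 -lt0n bin_gt0 leq_addr.
have kn : (k + n).+1%:R = k.+1%:R + n%:R :> R by rewrite -addSn natrD.
have kn0 : k.+1%:R + n%:R != 0 :> R by rewrite -kn pnatr_eq0.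
have : (k.+1%:R + n%:R) * ('C(k + n, k))%:R = k.+1%:R * B.
  by rewrite -kn /B -!natrM mul_bin_diag.
move=> /(canRL (mulKf kn0)) ->; rewrite /= kn.
by move: kn0; move: (k.+1%:R) (n%:R) => K M KM; field; rewrite b0 KM.
Qed.

Theorem theorem6p1 (R : realType) (d : nat) (lambda mu : R)
    (Q : nat -> seq (mpoly.mpoly d R)) (x : euclidean R d) :
  (2 <= d)%N ->
  0 < lambda ->
  - 2^-1 <= mu ->
  (forall n : nat, orthogonal_basis mu lambda n (Q n)) ->
  enorm x = 1 ->
  (fun n : nat =>
     polynomial_kernel mu lambda (Q n) x x / ('C(n + d - 1, n))%:R)
    @ \oo --> (2 / lambda : R).
Proof.
case: d Q x => [//|e] Q x _ lambda0 _ oQ x1.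
(* The term of index 0 is dropped, so that the degree is a successor as in the bounds. *)
rewrite -cvg_shiftS/=.
pose r (k : nat) : R := 2 - e%:R * harmonic (k + e)%N.
pose L (k : nat) := lambda + 2 * (radial_moment e.+1 mu (k.+1 + k.+1) + radial_moment e.+1 mu (k + k)).
have r2 : r k @[k --> \oo] --> (2 : R).
  rewrite -[X in _ --> X]subr0 -(mulr0 e%:R); apply: cvgB; first exact: cvg_cst.
  apply: cvgM; first exact: cvg_cst.
  by rewrite (cvg_shiftn e (@harmonic R)); exact: cvg_harmonic.
have double : (fun k => k + k)%N @ \oo --> \oo.
  apply/cvgnyPge => A; near=> k; apply: (@leq_trans k); last exact: leq_addr.
  by near: k; exact: nbhs_infty_ge.
have L0 : L k @[k --> \oo] --> lambda.
  have e0 := cvg_radial_moment e.+1 mu.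
  rewrite -[X in _ --> X]addr0 -(mulr0 2) -(addr0 0).
  apply: cvgD; first exact: cvg_cst.
  apply: cvgM; first exact: cvg_cst.
  apply: cvgD; last exact: cvg_comp double e0.
  rewrite (cvg_shiftS (fun k => radial_moment e.+1 mu (k + k))).
  exact: cvg_comp double e0.
apply: (@squeeze_cvgr _ _ _ _ (fun k => r k / L k) (fun k => r k / lambda)).
- apply: nearW => k; rewrite addnS subn1 /= /r -pair_dim_ratio.
  have b0 : 0 < ('C(k.+1 + e, k.+1))%:R :> R by rewrite ltr0n bin_gt0 leq_addr.
  rewrite [_ / _ / L k]mulrAC [_ / _ / lambda]mulrAC !ler_pM2r ?invr_gt0//.
  by rewrite polynomial_kernel_ge//= polynomial_kernel_le.
- by apply: cvgM => //; apply: cvgV => //; rewrite gt_eqF.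
- by apply: cvgM => //; exact: cvg_cst.
Unshelve. all: by end_near. Qed.
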